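(* The quantum $2$-spheres are all homologically smooth. That is, for all $q\in\mathbb{R}^\times$ not a root of unity and all $u,v\in\mathbb{R}$ with $u+v\neq0$, the $\mathbb{C}$-algebra generated by $X,Y,Z$ subject to $$XZ=q^2ZX,\quad ZY=q^2YZ,\quad YX=uv+(u-v)Z-Z^2,\quad XY=uv+q^2(u-v)Z-q^4Z^2$$ is homologically smooth.
   Context: A $\mathbb{C}$-algebra $A$ is homologically smooth if $A$ has a finitely generated projective resolution of finite length as a module over $A^e=A\otimes_{\mathbb{C}}A^{\mathrm{op}}$. *)

(* Defs.v *)
From HB Require Import structures.
From mathcomp Require Import all_boot all_algebra finmap.
From mathcomp Require Import boolp functions reals complex.
From mathcomp Require Import monalg.

Set Implicit Arguments.
Unset Strict Implicit.
Unset Printing Implicit Defensive.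

Import GRing.Theory.

Local Open Scope ring_scope.
Local Open Scope quotient_scope.
Local Open Scope complex_scope.

Section ModuleQuotient.
Variables (K : nzRingType) (V : lmodType K) (S : V -> Prop).

Inductive submod_gen : V -> Prop :=
| submod_gen0 : submod_gen 0
| submod_genS x : S x -> submod_gen x
| submod_genP k x y : submod_gen x -> submod_gen y -> submod_gen (k *: x + y).

Definition in_submod_gen : {pred V} := fun x => `[< submod_gen x >].

Lemma in_submod_gen_closed : zmod_closed in_submod_gen.
Proof.
split=> [|x y /asboolP Sx /asboolP Sy]; apply/asboolP; first exact: submod_gen0.
by rewrite addrC -scaleN1r; apply: submod_genP.
Qed.
HB.instance Definition _ :=
  GRing.isZmodClosed.Build V in_submod_gen in_submod_gen_closed.

Definition mod_quot := Quotient.quot in_submod_gen.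
HB.instance Definition _ := GRing.Zmodule.on mod_quot.

Definition mod_proj (x : V) : mod_quot := \pi_(Quotient.quot in_submod_gen) x.

Lemma mod_projP x y : mod_proj x = mod_proj y <-> submod_gen (x - y).
Proof.
rewrite /mod_proj; split=> [/eqP|Sxy]; last apply/eqP.
  by rewrite -Quotient.idealrBE => /asboolP.
by rewrite -Quotient.idealrBE; apply/asboolP.
Qed.

Definition mod_repr (x : mod_quot) : V :=
  repr (x : Quotient.quot in_submod_gen).

Lemma mod_reprK : cancel mod_repr mod_proj.
Proof. by move=> x; rewrite /mod_proj /mod_repr reprK. Qed.

Lemma mod_projB x y : mod_proj (x - y) = mod_proj x - mod_proj y.
Proof. by rewrite /mod_proj raddfB. Qed.
Lemma mod_projD x y : mod_proj (x + y) = mod_proj x + mod_proj y.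
Proof. by rewrite /mod_proj raddfD. Qed.

Definition mod_scale k (x : mod_quot) := mod_proj (k *: mod_repr x).

Lemma mod_scaleE k x : mod_scale k (mod_proj x) = mod_proj (k *: x).
Proof.
apply/mod_projP; rewrite -scalerBr -[_ *: _]addr0.
by apply: submod_genP (submod_gen0); apply/mod_projP; rewrite mod_reprK.
Qed.

Lemma mod_scaleA a b x : mod_scale a (mod_scale b x) = mod_scale (a * b) x.
Proof. by rewrite -[x]mod_reprK !mod_scaleE scalerA. Qed.
Lemma mod_scale1 : left_id 1 mod_scale.
Proof. by move=> x; rewrite -[x]mod_reprK !mod_scaleE scale1r. Qed.
Lemma mod_scaleDr : right_distributive mod_scale +%R.
Proof.
move=> k x y; rewrite -[x]mod_reprK -[y]mod_reprK.
by rewrite -mod_projD !mod_scaleE -mod_projD scalerDr.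
Qed.
Lemma mod_scaleDl x : {morph mod_scale^~ x : a b / a + b}.
Proof.
by move=> a b; rewrite -[x]mod_reprK !mod_scaleE -mod_projD scalerDl.
Qed.
HB.instance Definition _ := GRing.Zmodule_isLmodule.Build K mod_quot
  mod_scaleA mod_scale1 mod_scaleDr mod_scaleDl.

Lemma mod_proj_linear : linear mod_proj.
Proof. by move=> k x y; rewrite mod_projD -mod_scaleE. Qed.
HB.instance Definition _ :=
  GRing.isLinear.Build K V mod_quot *:%R mod_proj mod_proj_linear.

End ModuleQuotient.

Section MalgLift.
Variables (I : choiceType) (K : nzRingType) (M : lmodType K) (h : I -> M).

Definition malg_lift (g : {malg K[I]}) : M := \sum_(i <- msupp g) g@_i *: h i.

Lemma malg_liftw (d : {fset I}) (g : {malg K[I]}) :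
  (msupp g `<=` d)%fset -> malg_lift g = \sum_(i <- d) g@_i *: h i.
Proof.
move=> le; rewrite [LHS](big_fset_incl _ le) => //= x xd /mcoeff_outdom ->.
by rewrite scale0r.
Qed.

Lemma malg_lift_linear : linear malg_lift.
Proof.
move=> k g1 g2; pose d := (msupp g1 `|` msupp g2 `|` msupp (k *: g1 + g2))%fset.
have le1 : (msupp g1 `<=` d)%fset by rewrite /d -fsetUA fsubsetUl.
have le2 : (msupp g2 `<=` d)%fset by rewrite /d fsetUAC fsubsetUr.
have le3 : (msupp (k *: g1 + g2) `<=` d)%fset by rewrite /d fsubsetUr.
rewrite (malg_liftw le1) (malg_liftw le2) (malg_liftw le3).
rewrite scaler_sumr -big_split /=; apply: eq_bigr => i _.
by rewrite mcoeffD mcoeffZ scalerDl scalerA.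
Qed.
HB.instance Definition _ :=
  GRing.isLinear.Build K {malg K[I]} M *:%R malg_lift malg_lift_linear.

Lemma malg_liftU i : malg_lift << i >> = h i.
Proof. by rewrite (malg_liftw msuppU_le) big_seq_fset1 mcoeffUU scale1r. Qed.

End MalgLift.

Definition bilinear_map (K : comNzRingType) (A B M : lmodType K)
    (f : A -> B -> M) : Prop :=
  (forall b, linear (f^~ b)) /\ (forall a, linear (f a)).

Section Tensor.
Variables (K : comNzRingType) (A B : algType K).

Inductive tensor_rel : {malg K[(A * B)%type]} -> Prop :=
| tensor_relDl k a a' b :
    tensor_rel (<< (k *: a + a', b) >> - (k *: << (a, b) >> + << (a', b) >>))
| tensor_relDr k a b b' :
    tensor_rel (<< (a, k *: b + b') >> - (k *: << (a, b) >> + << (a, b') >>)).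

Definition tensor := mod_quot tensor_rel.
HB.instance Definition _ := GRing.Lmodule.on tensor.

Definition tens (a : A) (b : B) : tensor :=
  mod_proj tensor_rel << (a, b) >>.

Lemma tens_bilin : bilinear_map tens.
Proof.
split=> [b k a a'|a k b b']; rewrite /tens -mod_proj_linear; apply/mod_projP.
  by apply: submod_genS; apply: tensor_relDl.
by apply: submod_genS; apply: tensor_relDr.
Qed.

Definition tensor_lift (M : lmodType K) (f : A -> B -> M) (x : tensor) : M :=
  malg_lift (fun p => f p.1 p.2) (mod_repr x).

Section Lift.
Variables (M : lmodType K) (f : A -> B -> M) (f_bilin : bilinear_map f).

Lemma tensor_lift_proj x : tensor_lift f (mod_proj tensor_rel x) =
  malg_lift (fun p => f p.1 p.2) x.
Proof.
apply/eqP; rewrite -subr_eq0 -linearB /=.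
have : submod_gen tensor_rel (mod_repr (mod_proj tensor_rel x) - x).
  by apply/mod_projP; rewrite mod_reprK.
elim=> [|y|k y z _ /eqP IHy _ /eqP IHz]; first by rewrite linear0.
  by case=> [k a a' b|k a b b']; rewrite linearB /= malg_lift_linear !malg_liftU /=
    ?f_bilin.1 ?f_bilin.2 subrr.
by rewrite malg_lift_linear IHy IHz scaler0 addr0.
Qed.

Lemma tensor_lift_linear : linear (tensor_lift f).
Proof.
move=> k x y; rewrite -[x]mod_reprK -[y]mod_reprK -mod_proj_linear.
by rewrite !tensor_lift_proj malg_lift_linear.
Qed.

Lemma tensor_liftE a b : tensor_lift f (tens a b) = f a b.
Proof. by rewrite tensor_lift_proj malg_liftU. Qed.
End Lift.

Lemma tensor_lift_comb (M : lmodType K) k (f g h : A -> B -> M) x :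
  (forall a b, f a b = k *: g a b + h a b) ->
  tensor_lift f x = k *: tensor_lift g x + tensor_lift h x.
Proof.
move=> Ef; rewrite /tensor_lift /malg_lift scaler_sumr -big_split /=.
by apply: eq_bigr => i _; rewrite Ef scalerDr !scalerA mulrC.
Qed.

Lemma tensor_ind (P : tensor -> Prop) :
  (forall a b, P (tens a b)) -> (forall k x y, P x -> P y -> P (k *: x + y)) ->
  forall x, P x.
Proof.
move=> Pt PP x; have P0 : P 0.
  by rewrite -[0](addNr (tens 1 1)) -scaleN1r; apply: PP.
rewrite -[x]mod_reprK [mod_repr x]monalgE linear_sum /=.
elim/big_ind: _ => // [y z Py Pz|[a b] _].
  by rewrite -[y]scale1r; apply: PP.
have -> : << (mod_repr x)@_(a, b) *g (a, b) >> =
          (mod_repr x)@_(a, b) *: << (a, b) >> :> {malg K[(A * B)%type]}.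
  by apply/malgP => i; rewrite mcoeffZ !mcoeffU mulr_natr.
by rewrite linearZ /= -[X in P X]addr0; apply: PP (Pt _ _) P0.
Qed.

(* The multiplication is the bilinear extension of tens_mulE below: the inner
   lift is multiplication by a pure tensor, the outer one is taken with values
   in the pointwise module of maps tensor -> tensor. *)
Definition tens_mull (a : A) (b : B) : tensor -> tensor :=
  tensor_lift (fun a' b' => tens (a * a') (b * b')).

Definition tens_mul (x y : tensor) : tensor :=
  tensor_lift (tens_mull : A -> B -> (tensor -> tensor)) x y.

Lemma tens_mull_bilin0 a b :
  bilinear_map (fun a' b' => tens (a * a') (b * b')).
Proof.
split=> [b' k x y|a' k x y]; rewrite mulrDr -scalerAr.
  exact: tens_bilin.1.
exact: tens_bilin.2.
Qed.

Lemma tens_mull_bilin :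
  bilinear_map (tens_mull : A -> B -> (tensor -> tensor)).
Proof.
split=> [b k a a'|a k b b']; apply/funext => x;
    apply: tensor_lift_comb => c d.
  by rewrite mulrDl -scalerAl tens_bilin.1.
by rewrite mulrDl -scalerAl tens_bilin.2.
Qed.

Lemma tens_mul_linearl y : linear (tens_mul^~ y).
Proof.
move=> k x x'.
exact: (congr1 (@^~ y) (tensor_lift_linear tens_mull_bilin k x x')).
Qed.

Lemma tens_mullE a b y : tens_mul (tens a b) y = tens_mull a b y.
Proof. by rewrite /tens_mul (tensor_liftE tens_mull_bilin). Qed.

Lemma tens_mulE a b a' b' :
  tens_mul (tens a b) (tens a' b') = tens (a * a') (b * b').
Proof. by rewrite tens_mullE /tens_mull (tensor_liftE (tens_mull_bilin0 a b)). Qed.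

Lemma tens_mul_linearr x : linear (tens_mul x).
Proof.
move=> k y y'; elim/tensor_ind: x => [a b|l x x' IHx IHx'].
  by rewrite !tens_mullE; apply: tensor_lift_linear (tens_mull_bilin0 a b) _ _ _.
rewrite !tens_mul_linearl IHx IHx' !scalerDr !scalerA [k * l]mulrC.
by rewrite addrACA.
Qed.

Lemma tens_mulA : associative tens_mul.
Proof.
move=> x y z; elim/tensor_ind: x => [a b|k x x' IHx IHx'];
  last by rewrite !tens_mul_linearl IHx IHx'.
elim/tensor_ind: y => [a' b'|k y y' IHy IHy'];
  last by rewrite tens_mul_linearl !tens_mul_linearr tens_mul_linearl IHy IHy'.
elim/tensor_ind: z => [a'' b''|k z z' IHz IHz'];
  last by rewrite !tens_mul_linearr IHz IHz'.
by rewrite !tens_mulE !mulrA.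
Qed.

Lemma tens_mul1l : left_id (tens 1 1) tens_mul.
Proof.
elim/tensor_ind=> [a b|k x y IHx IHy]; first by rewrite tens_mulE !mul1r.
by rewrite tens_mul_linearr IHx IHy.
Qed.

Lemma tens_mul1r : right_id (tens 1 1) tens_mul.
Proof.
elim/tensor_ind=> [a b|k x y IHx IHy]; first by rewrite tens_mulE !mulr1.
by rewrite tens_mul_linearl IHx IHy.
Qed.

Lemma tens_mulDl : left_distributive tens_mul +%R.
Proof.
by move=> x y z; rewrite -[x]scale1r tens_mul_linearl !scale1r.
Qed.

Lemma tens_mulDr : right_distributive tens_mul +%R.
Proof.
by move=> x y z; rewrite -[y]scale1r tens_mul_linearr !scale1r.
Qed.

HB.instance Definition _ := GRing.Zmodule_isPzRing.Build tensor
  tens_mulA tens_mul1l tens_mul1r tens_mulDl tens_mulDr.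

Lemma tensM a b a' b' : tens a b * tens a' b' = tens (a * a') (b * b').
Proof. exact: tens_mulE. Qed.

Lemma tensor_scalerAl k (x y : tensor) : k *: (x * y) = (k *: x) * y.
Proof.
have E : (k *: x + 0) * y = k *: (x * y) + 0 * y := tens_mul_linearl y k x 0.
by move: E; rewrite addr0 mul0r addr0.
Qed.

Lemma tensor_scalerAr k (x y : tensor) : k *: (x * y) = x * (k *: y).
Proof.
have E : x * (k *: y + 0) = k *: (x * y) + x * 0 := tens_mul_linearr x k y 0.
by move: E; rewrite addr0 mulr0 addr0.
Qed.

End Tensor.

Section Converse.
Variables (K : comNzRingType) (A : algType K).

HB.instance Definition _ := GRing.Zmodule_isLmodule.Build K A^c
  (@scalerA K A) (@scale1r K A) (@scalerDr K A) (@scalerDl K A).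
Lemma converse_scalerAl k (x y : A^c) : k *: (x * y) = (k *: x) * y.
Proof. exact: (@scalerAr K A k y x). Qed.
HB.instance Definition _ :=
  GRing.LSemiModule_isLSemiAlgebra.Build K A^c converse_scalerAl.
Lemma converse_scalerAr k (x y : A^c) : k *: (x * y) = x * (k *: y).
Proof. exact: (@scalerAl K A k y x). Qed.
HB.instance Definition _ :=
  GRing.LSemiAlgebra_isSemiAlgebra.Build K A^c converse_scalerAr.
End Converse.

Definition enveloping (K : comNzRingType) (A : algType K) : pzRingType :=
  tensor A A^c.

Section RegularBimodule.
Variables (K : comNzRingType) (A : algType K).

(* A seen as a left module over its enveloping algebra: (a (x) b) m = a m b. *)
Definition regular_bimodule : Type := A.
HB.instance Definition _ := GRing.Zmodule.on regular_bimodule.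

Definition env_mul (a : A) (b : A^c) : A -> A := fun m => a * m * (b : A).

Definition env_act (x : enveloping A) (m : regular_bimodule) :
  regular_bimodule := tensor_lift (env_mul : A -> A^c -> (A -> A)) x m.

Lemma env_mul_bilin : bilinear_map (env_mul : A -> A^c -> (A -> A)).
Proof.
split=> [b k a a'|a k b b']; apply/funext => m.
  rewrite /env_mul !mulrDl -!scalerAl.
  by [].
rewrite /env_mul mulrDr -scalerAr.
by [].
Qed.

Lemma env_actE a b (m : A) : env_act (tens a (b : A^c)) m = a * m * b.
Proof. by rewrite /env_act (tensor_liftE env_mul_bilin). Qed.

Lemma env_act_linearl (m : A) :
  linear ((fun x => env_act x m) : tensor A A^c -> A).
Proof.
move=> k x x'.
exact: (congr1 (@^~ m) (tensor_lift_linear env_mul_bilin k x x')).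
Qed.

Lemma env_actDr (x : enveloping A) (m m' : A) :
  env_act x (m + m') = env_act x m + env_act x m'.
Proof.
elim/tensor_ind: x => [a b|k x x' IHx IHx'].
  by rewrite !env_actE mulrDr mulrDl.
by rewrite !env_act_linearl IHx IHx' scalerDr addrACA.
Qed.

Lemma env_actZr (x : enveloping A) k (m : A) :
  env_act x (k *: m) = k *: (env_act x m : A).
Proof.
elim/tensor_ind: x => [a b|l x x' IHx IHx'].
  by rewrite !env_actE -scalerAr -scalerAl.
by rewrite !env_act_linearl IHx IHx' scalerDr !scalerA mulrC.
Qed.

Lemma env_actA x y m : env_act x (env_act y m) = env_act (x * y) m.
Proof.
elim/tensor_ind: x => [a b|k x x' IHx IHx'].
  elim/tensor_ind: y => [a' b'|k y y' IHy IHy'].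
    by rewrite tensM !env_actE !mulrA.
  rewrite mulrDr -tensor_scalerAr !env_act_linearl env_actDr env_actZr.
  by rewrite IHy IHy'.
by rewrite mulrDl -tensor_scalerAl !env_act_linearl IHx IHx'.
Qed.

Lemma env_act1 : left_id 1 env_act.
Proof. by move=> m; rewrite env_actE mul1r mulr1. Qed.

Lemma env_actDl m : {morph env_act^~ m : x y / x + y}.
Proof.
by move=> x y; rewrite -[x]scale1r env_act_linearl !scale1r.
Qed.

HB.instance Definition _ :=
  GRing.Zmodule_isLmodule.Build (enveloping A) regular_bimodule
    env_actA env_act1 env_actDr env_actDl.

End RegularBimodule.

Definition finitely_generated (E : pzRingType) (P : lmodType E) : Prop :=
  exists (n : nat) (s : 'I_n -> P),
    forall x, exists c : 'I_n -> E, x = \sum_(i < n) c i *: s i.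

Definition projective (E : pzRingType) (P : lmodType E) : Prop :=
  forall (M N : lmodType E) (g : {linear M -> N}) (f : {linear P -> N}),
    (forall y, exists x, g x = y) ->
    exists h : {linear P -> M}, forall x, g (h x) = f x.

(* ... -> P 2 -> P 1 -> P 0 -> M -> 0 is exact, where d i : P i.+1 -> P i. *)
Definition is_resolution (E : pzRingType) (M : lmodType E)
    (P : nat -> lmodType E) (d : forall i, {linear P i.+1 -> P i})
    (eps : {linear P 0%N -> M}) : Prop :=
  [/\ forall m, exists x, eps x = m,
      forall x, eps x = 0 <-> exists y, d 0%N y = x
    & forall i x, d i x = 0 <-> exists y, d i.+1 y = x].

Definition homologically_smooth (K : comNzRingType) (A : algType K) : Prop :=
  exists (P : nat -> lmodType (enveloping A))
         (d : forall i, {linear P i.+1 -> P i})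
         (eps : {linear P 0%N -> regular_bimodule A}),
    [/\ is_resolution d eps,
        forall i, finitely_generated (P i) /\ projective (P i)
      & exists n : nat, forall i, (n < i)%N -> forall x : P i, x = 0].

Section AlgebraQuotient.
Variables (K : comNzRingType) (F : algType K) (S : F -> Prop).

Inductive ideal_gen : F -> Prop :=
| ideal_gen0 : ideal_gen 0
| ideal_genS x : S x -> ideal_gen x
| ideal_genB x y : ideal_gen x -> ideal_gen y -> ideal_gen (x - y)
| ideal_genMl a x : ideal_gen x -> ideal_gen (a * x)
| ideal_genMr a x : ideal_gen x -> ideal_gen (x * a).

(* ideal_gen is already a K-submodule, so this is the quotient by it. *)
Definition alg_quot := mod_quot ideal_gen.
HB.instance Definition _ := GRing.Lmodule.on alg_quot.

Definition alg_proj (x : F) : alg_quot := mod_proj ideal_gen x.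
HB.instance Definition _ := GRing.isLinear.Build K F alg_quot *:%R alg_proj
  (mod_proj_linear ideal_gen).

Definition alg_repr (x : alg_quot) : F := mod_repr x.

Lemma alg_reprK : cancel alg_repr alg_proj.
Proof. exact: mod_reprK. Qed.

Lemma alg_projP x y : alg_proj x = alg_proj y <-> ideal_gen (x - y).
Proof.
split=> [/mod_projP|Sxy]; last by apply/mod_projP; apply: submod_genS.
elim=> [|//|k {}x {}y _ Ix _ Iy]; first exact: ideal_gen0.
rewrite -[y]opprK -[- y]sub0r; apply: ideal_genB.
  by rewrite -[x]mul1r scalerAl; apply: ideal_genMl.
by apply: ideal_genB Iy; apply: ideal_gen0.
Qed.

Definition aq_mul (x y : alg_quot) := alg_proj (alg_repr x * alg_repr y).

Lemma aq_mulE x y : aq_mul (alg_proj x) (alg_proj y) = alg_proj (x * y).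
Proof.
apply/alg_projP; set x' := alg_repr _; set y' := alg_repr _.
have -> : x' * y' - x * y = x' * (y' - y) - (x - x') * y.
  by rewrite mulrBr mulrBl opprB addrA subrK.
by apply: ideal_genB; [apply: ideal_genMl | apply: ideal_genMr];
  apply/alg_projP; rewrite alg_reprK.
Qed.

Lemma aq_mulA : associative aq_mul.
Proof.
move=> x y z; rewrite -[x]alg_reprK -[y]alg_reprK -[z]alg_reprK.
by rewrite !aq_mulE mulrA.
Qed.
Lemma aq_mul1l : left_id (alg_proj 1) aq_mul.
Proof. by move=> x; rewrite -[x]alg_reprK aq_mulE mul1r. Qed.
Lemma aq_mul1r : right_id (alg_proj 1) aq_mul.
Proof. by move=> x; rewrite -[x]alg_reprK aq_mulE mulr1. Qed.
Lemma aq_mulDl : left_distributive aq_mul +%R.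
Proof.
move=> x y z; rewrite -[x]alg_reprK -[y]alg_reprK -[z]alg_reprK.
by rewrite -linearD !aq_mulE mulrDl linearD.
Qed.
Lemma aq_mulDr : right_distributive aq_mul +%R.
Proof.
move=> x y z; rewrite -[x]alg_reprK -[y]alg_reprK -[z]alg_reprK.
by rewrite -linearD !aq_mulE mulrDr linearD.
Qed.
HB.instance Definition _ := GRing.Zmodule_isPzRing.Build alg_quot
  aq_mulA aq_mul1l aq_mul1r aq_mulDl aq_mulDr.

Lemma alg_proj_monoid_morphism : monoid_morphism alg_proj.
Proof. by split=> // x y; rewrite -aq_mulE. Qed.
HB.instance Definition _ :=
  GRing.isMonoidMorphism.Build F alg_quot alg_proj alg_proj_monoid_morphism.

Lemma alg_projZ k x : alg_proj (k *: x) = k *: alg_proj x.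
Proof. exact: linearZ. Qed.
Lemma alg_projM x y : alg_proj (x * y) = alg_proj x * alg_proj y.
Proof. exact: rmorphM. Qed.

Lemma aq_scalerAl k (x y : alg_quot) : k *: (x * y) = (k *: x) * y.
Proof.
rewrite -[x]alg_reprK -[y]alg_reprK.
by rewrite -alg_projM -!alg_projZ -alg_projM scalerAl.
Qed.
Lemma aq_scalerAr k (x y : alg_quot) : k *: (x * y) = x * (k *: y).
Proof.
rewrite -[x]alg_reprK -[y]alg_reprK.
by rewrite -alg_projM -!alg_projZ -alg_projM scalerAr.
Qed.
End AlgebraQuotient.

Section FreeAlgebra.
Variables (I : choiceType) (K : comNzRingType).

Lemma malg_scalerAr k (x y : {malg K[{fmonom I}]}) :
  k *: (x * y) = x * (k *: y).
Proof.
apply/malgP => m.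
apply: etrans (mcoeffZ k (x * y) m) _.
apply: etrans (congr1 ( *%R k) (mcoeffMl x y m)) _.
apply: etrans _ (esym (mcoeffMlw m (fsubset_refl _) (msuppZ_le k y))).
rewrite mulr_sumr; apply: eq_bigr => i _; rewrite mulr_sumr.
by apply: eq_bigr => j _; rewrite mcoeffZ mulrnAr mulrCA.
Qed.

Definition free_algebra := {malg K[{fmonom I}]}.
HB.instance Definition _ := GRing.Lalgebra.on free_algebra.
HB.instance Definition _ :=
  GRing.LSemiAlgebra_isSemiAlgebra.Build K free_algebra malg_scalerAr.

Definition free_gen (i : I) : free_algebra := << fmu i >>.

Definition fmonom_eval (v : I -> K) (m : {fmonom I}) : K := \prod_(i <- m) v i.
Lemma fmonom_eval_morph v : mmorphism (fmonom_eval v).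
Proof.
by split=> [m1 m2|]; rewrite /fmonom_eval ?fmM ?big_cat // fm1 big_nil.
Qed.
HB.instance Definition _ v :=
  isMultiplicative.Build {fmonom I} K (fmonom_eval v) (fmonom_eval_morph v).

Definition free_eval (v : I -> K) : free_algebra -> K :=
  mmap idfun (fmonom_eval v).
HB.instance Definition _ v := GRing.RMorphism.on (free_eval v).

Lemma free_evalE v i : free_eval v (free_gen i) = v i.
Proof. by rewrite /free_eval mmapU mul1r /fmonom_eval fmU big_seq1. Qed.

Lemma free_evalB v x y : free_eval v (x - y) = free_eval v x - free_eval v y.
Proof. exact: rmorphB. Qed.
Lemma free_evalD v x y : free_eval v (x + y) = free_eval v x + free_eval v y.
Proof. exact: rmorphD. Qed.
Lemma free_evalM v x y : free_eval v (x * y) = free_eval v x * free_eval v y.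
Proof. exact: rmorphM. Qed.
Lemma free_eval1 v : free_eval v 1 = 1.
Proof. exact: rmorph1. Qed.
Lemma free_evalZ v k x : free_eval v (k *: x) = k * free_eval v x.
Proof. exact: mmapZ. Qed.

End FreeAlgebra.

Lemma sphere_rel_eval_aux (K : comNzRingType) (F : algType K) (f : F -> K)
    (x y z : F) (uv : K) :
  (forall a b, f (a - b) = f a - f b) -> (forall a b, f (a + b) = f a + f b) ->
  (forall a b, f (a * b) = f a * f b) -> (forall k a, f (k *: a) = k * f a) ->
  (forall k, f k%:A = k) -> f x = uv -> f y = 1 -> f z = 0 ->
  forall a b c d : K,
  [/\ f (x * z - a *: (z * x)) = 0, f (z * y - a *: (y * z)) = 0,
      f (y * x - (uv%:A + b *: z - z ^+ 2)) = 0
    & f (x * y - (uv%:A + c *: z - d *: z ^+ 2)) = 0].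
Proof.
move=> fB fD fM fZ fA fx fy fz a b c d.
split; rewrite !(fB, fD, fA, fZ, fM, expr2, fx, fy, fz).
- by rewrite !mul0r !mulr0 subrr.
- by rewrite !mul0r !mulr0 subrr.
- by rewrite !mulr0 addr0 subr0 mul1r subrr.
- by rewrite !mulr0 addr0 subr0 mulr1 subrr.
Qed.

Section QuantumSphere.
Variables (R : realType) (q u v : R).

Local Notation C := R[i].
Local Notation F := (free_algebra 'I_3 C).
Local Notation X := (free_gen C (inord 0 : 'I_3)).
Local Notation Y := (free_gen C (inord 1 : 'I_3)).
Local Notation Z := (free_gen C (inord 2 : 'I_3)).

Inductive sphere_rel : F -> Prop :=
| sphere_relXZ : sphere_rel (X * Z - (q ^+ 2)%:C *: (Z * X))
| sphere_relZY : sphere_rel (Z * Y - (q ^+ 2)%:C *: (Y * Z))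
| sphere_relYX : sphere_rel
    (Y * X - ((u * v)%:C%:A + (u - v)%:C *: Z - Z ^+ 2))
| sphere_relXY : sphere_rel
    (X * Y - ((u * v)%:C%:A + (q ^+ 2 * (u - v))%:C *: Z
              - (q ^+ 4)%:C *: Z ^+ 2)).

Definition quantum_sphere := alg_quot sphere_rel.
HB.instance Definition _ := GRing.PzRing.on quantum_sphere.
HB.instance Definition _ := GRing.Lmodule.on quantum_sphere.

(* The algebra is nonzero because X |-> uv, Y |-> 1, Z |-> 0 satisfies the
   relations. *)
Definition sphere_pt (i : 'I_3) : C :=
  if i == inord 0 then (u * v)%:C else if i == inord 1 then 1 else 0.

Lemma sphere_rel_eval r : sphere_rel r -> free_eval sphere_pt r = 0.
Proof.
have E0 : free_eval sphere_pt X = (u * v)%:C.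
  by rewrite free_evalE /sphere_pt eqxx.
have E1 : free_eval sphere_pt Y = 1.
  by rewrite free_evalE /sphere_pt -!val_eqE /= !inordK.
have E2 : free_eval sphere_pt Z = 0.
  by rewrite free_evalE /sphere_pt -!val_eqE /= !inordK.
have eA k : free_eval sphere_pt k%:A = k by rewrite free_evalZ free_eval1 mulr1.
have [] := sphere_rel_eval_aux (free_evalB _) (free_evalD _) (free_evalM _)
  (free_evalZ _) eA E0 E1 E2
  (q ^+ 2)%:C (u - v)%:C (q ^+ 2 * (u - v))%:C (q ^+ 4)%:C.
move=> rXZ rZY rYX rXY.
by case; [exact: rXZ | exact: rZY | exact: rYX | exact: rXY].
Qed.

Lemma sphere_eval_ideal x : ideal_gen sphere_rel x -> free_eval sphere_pt x = 0.
Proof.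
elim=> [|{}x Sx|{}x y _ Ix _ Iy|a {}x _ Ix|a {}x _ Ix].
- by rewrite rmorph0.
- exact: sphere_rel_eval.
- by rewrite free_evalB Ix Iy subrr.
- by rewrite free_evalM Ix mulr0.
- by rewrite free_evalM Ix mul0r.
Qed.

Lemma quantum_sphere_neq0 : (1 : quantum_sphere) != 0.
Proof.
apply/eqP => E.
have /alg_projP : alg_proj sphere_rel 1 = alg_proj sphere_rel 0.
  by rewrite rmorph0 rmorph1.
by move/sphere_eval_ideal/eqP; rewrite subr0 rmorph1 oner_eq0.
Qed.

HB.instance Definition _ :=
  GRing.PzSemiRing_isNonZero.Build quantum_sphere quantum_sphere_neq0.
HB.instance Definition _ := GRing.LSemiModule_isLSemiAlgebra.Build C
  quantum_sphere (@aq_scalerAl C F sphere_rel).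
HB.instance Definition _ := GRing.LSemiAlgebra_isSemiAlgebra.Build C
  quantum_sphere (@aq_scalerAr C F sphere_rel).

End QuantumSphere.

(* Main.v *)
Require Import Defs.
From HB Require Import structures.
From mathcomp Require Import all_boot all_algebra finmap.
From mathcomp Require Import boolp functions reals complex.
From mathcomp Require Import monalg ring.
From Stdlib Require Ncring Ncring_tac.

(** The quantum sphere is a generalized Weyl algebra: with p = q^2, c0 = uv,
    c1 = u - v and a(Z) = c0 + c1 Z - Z^2 = (u - Z)(v + Z), its relations say
    XZ = pZX, ZY = pYZ, YX = a(Z), XY = a(pZ).  The condition u + v != 0 says
    that a has simple roots, which here is the Bezout identity
    a'(Z)^2 + 4 a(Z) = c1^2 + 4 c0 = (u + v)^2.  The proof turns this
    identity into a resolution of length two over E = A (x) A^op.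

    For every algebra A = F/I given by generators x_j and relations r_i, the
    Jacobian matrix J of Fox derivatives of the r_i makes
    E^m -> E^n -> E -> A -> 0 exact: it presents the bimodule of
    noncommutative differentials of A ([diagonal_ideal], [jacobian_exact]).
    So A is homologically smooth, with a resolution of length two, as soon as
    the image of J is projective, that is, as soon as some matrix e satisfies
    eJ = J and kills ker J ([presented_smooth]).

    Write X1 = X (x) 1 and X2 = 1 (x) X, and similarly for Y and Z.  A row
    (x1, x2, x3, x4) in ker J satisfies three linear equations.  Eliminating
    between two of them and dividing by Z2 - Z1 gives
    x3 (c1 - Z1 - Z2) = x1 X1 + x2 Y2, and then the third one gives
    x4 (c1 - p Z1 - p Z2) = - (x1 X2 + x2 Y1)  ([cycle_YX], [cycle_XY]).  Here
    c1 - Z1 - Z2 is a'(Z1) up to a multiple of Z2 - Z1.  Since also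
    a(Z1) = Y1 X1, the Bezout identity writes (u + v)^2 (x3, x4) through
    the syzygies coming from the four overlaps YXZ, XYZ, XYX, YXY
    of the relations ([split_YX], [split_XY]); the coordinates x1 and x2 then
    follow, because Z2 - p Z1 and Z1 - p Z2 are regular.  This is the wanted e
    ([split_idempotent]).

    The divisions need that Z2 - l Z1 is regular in E.  A one-sided inverse of
    the multiplication by Z2 - l Z1 is obtained by a twisted divided difference
    A -> A (x) A, sending Z^k e_n to the sum of the l^i Z^i (x) Z^(k-1-i) e_n,
    where e_n is X^n or Y^(-n)  ([quantum_diagonal_regular]).  That this is well
    defined is the linear independence of the Z^k e_n, which holds because A
    acts on the free module on such symbols ([normal_form]). *)

Set Implicit Arguments.
Unset Strict Implicit.
Unset Printing Implicit Defensive.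

Import GRing.Theory.
Local Open Scope ring_scope.

(** * Linear maps and free modules *)

Lemma linear_fun0 (K : pzRingType) (U V : lmodType K) (f : U -> V) :
  linear f -> f 0 = 0.
Proof. by move=> /(_ (-1) 0 0); rewrite !scaleN1r oppr0 addr0 addNr. Qed.

Lemma malg_lin_ind (J : choiceType) (K : nzRingType)
    (P : {malg K[J]} -> Prop) :
  P 0 -> (forall j, P << j >>) ->
  (forall k f g, P f -> P g -> P (k *: f + g)) -> forall f, P f.
Proof.
move=> P0 Pj PP f; rewrite [f]monalgE.
elim/big_ind: _ => // [g h Pg Ph|j _]; first by rewrite -[g]scale1r; apply: PP.
have -> : << f@_j *g j >> = f@_j *: << j >> + 0 :> {malg K[J]}.
  by rewrite addr0; apply/malgP => i; rewrite mcoeffZ !mcoeffU mulr_natr.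
exact: PP.
Qed.

Lemma linear_fun_sum (K : pzRingType) (U V : lmodType K) (f : U -> V)
    (J : finType) (u : J -> U) :
  linear f -> f (\sum_j u j) = \sum_j f (u j).
Proof.
move=> f_lin; apply: (big_morph f) => [v w|]; last exact: linear_fun0.
by rewrite -[v]scale1r f_lin !scale1r.
Qed.

Lemma scale_comb3 (K : comNzRingType) (V : lmodType K) (l a b c : K)
    (v1 v2 v3 w1 w2 w3 : V) :
  a *: (l *: v1 + w1) + b *: (l *: v2 + w2) - c *: (l *: v3 + w3) =
  l *: (a *: v1 + b *: v2 - c *: v3) + (a *: w1 + b *: w2 - c *: w3).
Proof.
have E d v w : d *: (l *: v + w) = l *: (d *: v) + d *: w :> V.
  by rewrite scalerDr !scalerA mulrC.
by rewrite !E opprD [X in X + _ = _]addrACA [LHS]addrACA scalerBr scalerDr.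
Qed.

Lemma linear_comb3 (K : comNzRingType) (U V : lmodType K) (f : {linear U -> V})
    (a b c : K) (u v w : U) :
  f (a *: u + b *: v - c *: w) = a *: f u + b *: f v - c *: f w.
Proof. by rewrite linearB linearD !linearZ. Qed.

Lemma scaler_comb3 (K : pzRingType) (V : lmodType K) (d a b c : K) (u v w : V) :
  d *: (a *: u + b *: v - c *: w) = (d * a) *: u + (d * b) *: v - (d * c) *: w.
Proof. by rewrite scalerBr scalerDr !scalerA. Qed.

Lemma scale_factor (K : comNzRingType) (V : lmodType K) (p c : K) (u v w : V) :
  (p * c) *: u - (p * p) *: (v + w) = p *: (c *: u - (p *: v + p *: w)).
Proof. by rewrite -scalerDr scalerBr !scalerA. Qed.

(** Freeness as a universal property: linear maps out of M are given, and
    compared, on the family b. *)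
Record free_basis (K : nzRingType) (M : lmodType K) (I : Type) (b : I -> M) :=
  FreeBasis {
    basis_lift : forall V : lmodType K, (I -> V) -> {linear M -> V};
    basis_liftE : forall (V : lmodType K) (h : I -> V) i,
      basis_lift h (b i) = h i;
    basis_ext : forall (V : lmodType K) (f g : {linear M -> V}),
      (forall i, f (b i) = g (b i)) -> f =1 g
  }.

Definition malg_basis (K : nzRingType) (I : choiceType) :
  free_basis (fun i : I => << i >> : {malg K[I]}).
Proof.
exists (fun (V : lmodType K) (h : I -> V) =>
  malg_lift h : {linear {malg K[I]} -> V}) => [V h i|V f g fg].
  exact: malg_liftU.
elim/malg_lin_ind => [|i|k v w IHv IHw]; first by rewrite !linear0.
  exact: fg.
by rewrite (linearP f) (linearP g) IHv IHw.
Defined.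

(** * Actions of a free algebra *)

Section FreeAlgebra.
Variables (I : choiceType) (K : comNzRingType).
Local Notation F := (free_algebra I K).

Lemma free_gen_cons i (m : {fmonom I}) :
  free_gen K i * (<< m >> : F) = << mmul (fmu i) m >>.
Proof. by apply: etrans (fgmulUU _ _ _ _) _; rewrite mulr1. Qed.

Lemma free_ind (P : F -> Prop) :
  P 1 -> (forall i f, P f -> P (free_gen K i * f)) ->
  (forall k f g, P f -> P g -> P (k *: f + g)) -> forall f, P f.
Proof.
move=> P1 Pgen PP; apply: malg_lin_ind => //.
  by have := PP (-1) _ _ P1 P1; rewrite scaleN1r addNr.
move=> m; move: {2}(fmonom_val m) (erefl (fmonom_val m)) => s.
elim: s m => [|i s IHs] m ms.
  by have -> : m = mone by apply/eqP; rewrite fmP fm1 ms.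
have -> : m = mmul (fmu i) (FMonom s) by apply/eqP; rewrite fmP fmM fmU ms.
by rewrite -free_gen_cons; apply/Pgen/IHs.
Qed.

Section Action.
Variables (V : lmodType K) (T : I -> V -> V).
Hypothesis T_linear : forall i, linear (T i).

Definition free_act (f : F) (v : V) : V :=
  malg_lift (fun m : {fmonom I} => foldr T v m) f.

Lemma free_act_linearl v : linear (free_act^~ v).
Proof. exact: malg_lift_linear. Qed.

Lemma free_act1 v : free_act 1 v = v.
Proof. by rewrite /free_act malg_liftU fm1. Qed.

Lemma free_act_gen i f v : free_act (free_gen K i * f) v = T i (free_act f v).
Proof.
elim/malg_lin_ind: f => [|m|k f g IHf IHg].
- rewrite mulr0 (linear_fun0 (free_act_linearl v)).
  by rewrite (linear_fun0 (T_linear i)).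
- by rewrite free_gen_cons /free_act !malg_liftU fmM fmU.
have -> : free_gen K i * (k *: f + g : F) =
    k *: (free_gen K i * f) + free_gen K i * g.
  by rewrite mulrDr scalerAr.
rewrite (free_act_linearl v k f g) T_linear -IHf -IHg.
exact: free_act_linearl.
Qed.

Lemma free_actM f g v : free_act (f * g) v = free_act f (free_act g v).
Proof.
elim/free_ind: f => [|i f IHf|k f1 f2 IH1 IH2].
- by rewrite mul1r free_act1.
- have -> : free_gen K i * f * g = free_gen K i * (f * g) by rewrite mulrA.
  apply: etrans (free_act_gen i (f * g) v) _.
  exact: etrans (congr1 (T i) IHf) (esym (free_act_gen i f _)).
have -> : (k *: f1 + f2) * g = k *: (f1 * g) + f2 * g.
  by rewrite mulrDl scalerAl.
rewrite (free_act_linearl _ k f1 f2) -IH1 -IH2.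
exact: free_act_linearl.
Qed.

Lemma free_act_linearr f : linear (free_act f).
Proof.
move=> k v w; elim/free_ind: f => [|i f IHf|l f1 f2 IH1 IH2].
- by rewrite !free_act1.
- by rewrite !free_act_gen IHf T_linear.
rewrite !free_act_linearl IH1 IH2 !scalerDr !scalerA [k * l]mulrC.
by rewrite addrACA.
Qed.

End Action.
End FreeAlgebra.

Definition is_action (K : comNzRingType) (F : algType K) (V : lmodType K)
    (act : F -> V -> V) : Prop :=
  [/\ forall v, linear (act^~ v), forall f, linear (act f),
      forall v, act 1 v = v & forall f g v, act (f * g) v = act f (act g v)].

Lemma free_algebra_action (K : comNzRingType) (I : choiceType)
    (V : lmodType K) (T : I -> {linear V -> V}) :
  exists act : free_algebra I K -> V -> V,
    is_action act /\ forall i v, act (free_gen K i) v = T i v.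
Proof.
have T_lin i : linear (T i) by move=> k v w; rewrite linearP.
exists (free_act (fun i v => T i v)); split=> [|i v]; first split.
- exact: free_act_linearl.
- exact: free_act_linearr T_lin.
- exact: free_act1.
- exact: free_actM T_lin.
rewrite -[free_gen K i]mulr1; apply: etrans (free_act_gen T_lin i 1 v) _.
by rewrite free_act1.
Qed.

Lemma action_ideal (K : comNzRingType) (F : algType K) (V : lmodType K)
    (act : F -> V -> V) (S : F -> Prop) :
  is_action act -> (forall r v, S r -> act r v = 0) ->
  forall f, ideal_gen S f -> forall v, act f v = 0.
Proof.
move=> [act_linl act_linr act1 actM] S0 f.
elim=> [|{}f /S0//|{}f g _ IHf _ IHg|g {}f _ IHf|g {}f _ IHf] v //.
- exact: linear_fun0 (act_linl v).
- by rewrite addrC -scaleN1r act_linl IHf IHg scaler0 addr0.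
- by rewrite actM IHf (linear_fun0 (act_linr g)).
by rewrite actM IHf.
Qed.

(** * The enveloping algebra *)

Section Enveloping.
Variables (K : comNzRingType) (A : algType K).
Local Notation E := (tensor A A^c).

(** Multiplying by these two elements on the right of E inserts letters
    between the tensor factors: (s (x) t) lft a = sa (x) t and (s (x) t) rgt
    b = s (x) bt. On the left, they act by the outer bimodule structure. *)
Definition lft (a : A) : E := tens a (1 : A^c).
Definition rgt (b : A) : E := tens 1 (b : A^c).

Lemma lft_linear : linear lft.
Proof. by move=> k a b; apply: (tens_bilin A A^c).1. Qed.
Lemma rgt_linear : linear rgt.
Proof. by move=> k a b; apply: (tens_bilin A A^c).2. Qed.
Lemma lft1 : lft 1 = 1. Proof. by []. Qed.
Lemma rgt1 : rgt 1 = 1. Proof. by []. Qed.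
Lemma lftM a b : lft (a * b) = lft a * lft b.
Proof. by rewrite /lft tensM mulr1. Qed.
Lemma rgtM a b : rgt (a * b) = rgt b * rgt a.
Proof. by rewrite /rgt tensM mulr1. Qed.
Lemma lft_rgt a b : lft a * rgt b = tens a (b : A^c).
Proof. by rewrite /lft /rgt tensM mulr1 mul1r. Qed.
Lemma rgt_lft a b : rgt b * lft a = tens a (b : A^c).
Proof. by rewrite /lft /rgt tensM mulr1 mul1r. Qed.
Lemma rgt_lftC a b : rgt b * lft a = lft a * rgt b.
Proof. by rewrite lft_rgt rgt_lft. Qed.
Lemma lftD a b : lft (a + b) = lft a + lft b.
Proof. by have := lft_linear 1 a b; rewrite !scale1r. Qed.
Lemma rgtD a b : rgt (a + b) = rgt a + rgt b.
Proof. by have := rgt_linear 1 a b; rewrite !scale1r. Qed.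
Lemma lftZ k a : lft (k *: a) = k *: lft a.
Proof.
by have := lft_linear k a 0; rewrite addr0 (linear_fun0 lft_linear) addr0.
Qed.
Lemma rgtZ k a : rgt (k *: a) = k *: rgt a.
Proof.
by have := rgt_linear k a 0; rewrite addr0 (linear_fun0 rgt_linear) addr0.
Qed.
Lemma lftB a b : lft (a - b) = lft a - lft b.
Proof. by rewrite addrC -scaleN1r lft_linear scaleN1r addrC. Qed.
Lemma rgtB a b : rgt (a - b) = rgt a - rgt b.
Proof. by rewrite addrC -scaleN1r rgt_linear scaleN1r addrC. Qed.
Lemma env_scale_mull k (x y : E) : k *: x * y = k *: (x * y).
Proof. by rewrite tensor_scalerAl. Qed.
Lemma env_scale_mulr k (x y : E) : x * (k *: y) = k *: (x * y).
Proof. by rewrite tensor_scalerAr. Qed.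
Lemma env_scalar_mull k (t : E) : (k *: (1 : E)) * t = k *: t.
Proof. by rewrite env_scale_mull mul1r. Qed.
Lemma lft_quad a b d z : lft (a%:A + b *: z - d *: z ^+ 2) =
  a *: (1 : E) + b *: lft z - d *: (lft z * lft z).
Proof. by rewrite lftB lftD !lftZ lft1 lftM. Qed.
Lemma rgt_quad a b d z : rgt (a%:A + b *: z - d *: z ^+ 2) =
  a *: (1 : E) + b *: rgt z - d *: (rgt z * rgt z).
Proof. by rewrite rgtB rgtD !rgtZ rgt1 rgtM. Qed.
Lemma env_ind (P : E -> Prop) : (forall a b : A, P (lft a * rgt b)) ->
  (forall k x y, P x -> P y -> P (k *: x + y)) -> forall x, P x.
Proof. by move=> Pt; apply: tensor_ind => a b; rewrite -lft_rgt. Qed.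
End Enveloping.

(** * Fox calculus of a presented algebra *)

Section Presentation.
Variables (K : comNzRingType) (A F : algType K) (n m : nat).
Variables (x : 'I_n -> F) (pi : F -> A) (r : 'I_m -> F).
Local Notation E := (tensor A A^c).
Local Notation g j := (pi (x j)).

Definition generated : Prop := forall P : F -> Prop,
  P 1 -> (forall j f, P f -> P (x j * f)) ->
  (forall k f f', P f -> P f' -> P (k *: f + f')) -> forall f, P f.

(** F stands for the free algebra on the x_j. The freeness of F enters only
    through the Fox derivation below, so that F can be kept abstract. *)
Record presents : Prop := Presents {
  pres_gen : generated;
  pres_linear : linear pi;
  pres_1 : pi 1 = 1;
  pres_M : forall f f', pi (f * f') = pi f * pi f';
  pres_surj : forall a, exists f, pi f = a;
  pres_ker : forall f,
    pi f = 0 <-> ideal_gen (fun h => exists j, h = r j) f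
}.

(** The derivation F -> E^n along pi that sends x_j to the j-th basis row.
    The product rule is stated for multiplication by a generator only, which
    determines D because the x_j generate F; the general rule is foxM. *)
Record fox_derivation (D : F -> 'I_n -> E) : Prop := FoxDerivation {
  fox_linear : linear D;
  fox1 : D 1 = 0;
  fox_gen_mul : forall j f i, D (x j * f) i =
    lft (g j) * D f i + (if i == j then rgt (pi f) else 0)
}.

Definition jacobian (D : F -> 'I_n -> E) : 'M[enveloping A]_(m, n) :=
  \matrix_(j, i) D (r j) i.

Definition differential : 'M[enveloping A]_(n, 1) :=
  \matrix_(i, _) (lft (g i) - rgt (g i)).

Hypothesis pres : presents.
Variable D : F -> 'I_n -> E.
Hypothesis foxD : fox_derivation D.

Lemma foxE k f f' i : D (k *: f + f') i = k *: D f i + D f' i.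
Proof. by rewrite (fox_linear foxD). Qed.

Lemma foxM f1 f2 i :
  D (f1 * f2) i = lft (pi f1) * D f2 i + rgt (pi f2) * D f1 i.
Proof.
elim/(pres_gen pres): f1 => [|j f IHf|k f f' IH IH'].
- by rewrite (fox1 foxD) mulr0 addr0 (pres_1 pres) lft1 !mul1r.
- rewrite -mulrA !(fox_gen_mul foxD) IHf !(pres_M pres) lftM rgtM !mulrDr.
  rewrite !mulrA rgt_lftC -!addrA; congr (_ + (_ + _)).
  by case: eqP => _; rewrite ?mulr0.
rewrite mulrDl -scalerAl !foxE IH IH' (pres_linear pres) lft_linear mulrDl.
by rewrite !mulrDr env_scale_mull env_scale_mulr !scalerDr addrACA.
Qed.

(** Two derivations of F along pi are equal if they agree on the generators;
    the right-hand side is the one that sends x_i to lft (g i) - rgt (g i). *)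
Lemma fox_fundamental f :
  \sum_i D f i * (lft (g i) - rgt (g i)) = lft (pi f) - rgt (pi f).
Proof.
elim/(pres_gen pres): f => [|j f IHf|k f f' IH IH'].
- rewrite (pres_1 pres) lft1 rgt1 subrr big1 // => i _.
  by rewrite (fox1 foxD) mul0r.
- under eq_bigr do rewrite (fox_gen_mul foxD) mulrDl -mulrA.
  rewrite big_split /= -mulr_sumr IHf (bigD1 j) //= eqxx big1 ?addr0.
    by rewrite (pres_M pres) lftM rgtM !mulrBr rgt_lftC addrA subrK.
  by move=> i /negPf ->; rewrite mul0r.
under eq_bigr do rewrite foxE mulrDl env_scale_mull.
rewrite big_split /= -scaler_sumr IH IH' (pres_linear pres) lft_linear.
by rewrite rgt_linear scalerBr addrACA opprD.
Qed.

Lemma jacobian_differential : jacobian D *m differential = 0.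
Proof.
apply/matrixP => j k; rewrite mxE [RHS]mxE.
under eq_bigr do rewrite !mxE.
rewrite fox_fundamental; have /(pres_ker pres) -> : ideal_gen
  (fun h => exists j, h = r j) (r j) by apply: ideal_genS; exists j.
by rewrite (linear_fun0 (@lft_linear K A)) (linear_fun0 (@rgt_linear K A))
  subrr.
Qed.

(** Exactness at E: a (x) b - 1 (x) ab is rgt b times lft a - rgt a, and the
    fundamental formula for a lift of a writes the latter through the
    generators. *)
Lemma diagonal_ideal (t : E) : exists y : 'rV[enveloping A]_n,
  t - rgt (env_act t 1) = (y *m differential) 0 0.
Proof.
elim/env_ind: t => [a b|k t t' [y ty] [y' ty']].
  have [f <-] := pres_surj pres a.
  exists (\row_i (rgt b * D f i)); rewrite !mxE.
  under eq_bigr do rewrite !mxE -mulrA.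
  rewrite -mulr_sumr fox_fundamental mulrBr rgt_lftC -rgtM.
  by rewrite lft_rgt env_actE mulr1.
exists ((lft k%:A : enveloping A) *: y + y').
rewrite mulmxDl -scalemxAl [RHS]mxE [X in _ = X + _]mxE -ty -ty'.
rewrite env_act_linearl rgt_linear lftZ lft1 env_scale_mull mul1r.
by rewrite scalerBr addrACA opprD.
Qed.
End Presentation.

Section FoxExact.
Variables (K : comNzRingType) (A F : algType K) (n m : nat).
Variables (x : 'I_n -> F) (pi : F -> A) (r : 'I_m -> F).
Local Notation E := (tensor A A^c).
Local Notation g j := (pi (x j)).
Hypothesis pres : presents x pi r.
Variable D : F -> 'I_n -> E.
Hypothesis foxD : fox_derivation x pi D.

Definition relation_span (w : 'I_n -> E) : Prop :=
  exists z : 'rV[enveloping A]_m, forall i, w i = (z *m jacobian r D) 0 i.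

Lemma relation_span_comb (s t : E) w w' :
  relation_span w -> relation_span w' ->
  relation_span (fun i => s * w i + t * w' i).
Proof.
move=> [z wz] [z' wz'].
exists ((s : enveloping A) *: z + (t : enveloping A) *: z') => i.
by rewrite mulmxDl -!scalemxAl wz wz' [RHS]mxE [X in _ = X + _]mxE
  [X in _ = _ + X]mxE.
Qed.

Lemma relation_span_mul (s : E) w :
  relation_span w -> relation_span (fun i => s * w i).
Proof.
move=> Sw; have := relation_span_comb s 0 Sw Sw; congr relation_span.
by apply: funext => i; rewrite mul0r addr0.
Qed.

Lemma relation_span_lin k w w' :
  relation_span w -> relation_span w' -> relation_span (k *: w + w').
Proof.
move=> Sw Sw'; have := relation_span_comb (k *: (1 : E)) 1 Sw Sw'.
congr relation_span; apply: funext => i.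
by rewrite env_scale_mull !mul1r.
Qed.

Lemma relation_span0 : relation_span 0.
Proof. by exists 0 => i; rewrite mul0mx mxE. Qed.

Lemma relation_span_gen w : submod_gen relation_span w -> relation_span w.
Proof.
elim=> // [|k y z _ Sy _ Sz]; first exact: relation_span0.
exact: relation_span_lin.
Qed.

(** In the product rule for a multiple of f in the ideal, the term that
    differentiates the other factor carries pi f = 0. So the Fox rows of the
    ideal are combinations of those of the relations. *)
Lemma relation_span_fox f : pi f = 0 -> relation_span (D f).
Proof.
have ker := pres_ker pres; have piM := pres_M pres.
move/ker; elim=> [|h [j ->]|h h' _ Sh _ Sh'|a h kh Sh|a h kh Sh].
- by rewrite (linear_fun0 (fox_linear foxD)); apply: relation_span0.
- by exists (delta_mx 0 j) => i; rewrite -rowE !mxE.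
- have -> : D (h - h') = -1 *: D h' + D h.
    by rewrite -(fox_linear foxD) scaleN1r addrC.
  exact: relation_span_lin.
- have := relation_span_mul (lft (pi a)) Sh; congr relation_span.
  apply: funext => i; rewrite (foxM pres foxD).
  have /ker -> := kh.
  by rewrite (linear_fun0 (@rgt_linear K A)) mul0r addr0.
have := relation_span_mul (rgt (pi a)) Sh; congr relation_span.
apply: funext => i; rewrite (foxM pres foxD).
have /ker -> := kh.
by rewrite (linear_fun0 (@lft_linear K A)) mul0r add0r.
Qed.

Let Q := mod_quot relation_span.

(** The class, modulo the rows of the Jacobian, of D f multiplied by b on
    the right in the bimodule sense. It depends on pi f only, by
    relation_span_fox. *)
Definition fox_class (f : F) (b : A) : Q :=
  mod_proj relation_span (fun i => rgt b * D f i).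

Lemma fox_class_linearl b : linear (fox_class^~ b).
Proof.
move=> k f f'; rewrite /fox_class -mod_proj_linear; congr mod_proj.
by apply: funext => i; rewrite (foxE foxD) mulrDr env_scale_mulr.
Qed.

Lemma fox_class_linearr f : linear (fox_class f).
Proof.
move=> k b b'; rewrite /fox_class -mod_proj_linear; congr mod_proj.
by apply: funext => i; rewrite rgt_linear mulrDl env_scale_mull.
Qed.

Lemma fox_class_pi f f' b : pi f = pi f' -> fox_class f b = fox_class f' b.
Proof.
move=> ff'; apply: subr0_eq; rewrite -[- _]scaleN1r addrC -fox_class_linearl.
rewrite -[RHS](linear0 (mod_proj relation_span)).
apply/mod_projP; rewrite subr0; apply/submod_genS/relation_span_mul.
by apply: relation_span_fox; rewrite (pres_linear pres) ff' scaleN1r addNr.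
Qed.

Definition pres_section a : F := projT1 (cid (pres_surj pres a)).
Lemma pres_sectionK a : pi (pres_section a) = a.
Proof. exact: projT2 (cid (pres_surj pres a)). Qed.

(** A partial inverse of the differential: a (x) b goes to the derivative of
    a lift of a, times b. *)
Definition fox_lift : E -> Q :=
  tensor_lift (fun a (b : A^c) => fox_class (pres_section a) b).

Lemma fox_lift_bilin :
  bilinear_map (fun a (b : A^c) => fox_class (pres_section a) b).
Proof.
split=> [b k a a'|a k b b']; last exact: fox_class_linearr.
rewrite -fox_class_linearl; apply: fox_class_pi.
by rewrite (pres_linear pres) !pres_sectionK.
Qed.

Lemma fox_lift_linear : linear fox_lift.
Proof. exact: tensor_lift_linear fox_lift_bilin. Qed.

Lemma fox_liftE f b : fox_lift (lft (pi f) * rgt b) = fox_class f b.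
Proof.
rewrite lft_rgt /fox_lift (tensor_liftE fox_lift_bilin).
by apply: fox_class_pi; rewrite pres_sectionK.
Qed.

(** The differential of t e_j, for t = a (x) b, is a x_j (x) b - a (x) x_j
    b; the product rule for a x_j leaves exactly t e_j. *)
Lemma fox_lift_differential (t : E) j : fox_lift (t * (lft (g j) - rgt (g j))) =
  mod_proj relation_span (fun i => if i == j then t else 0).
Proof.
elim/env_ind: t => [a b|k t t' IH IH'].
  have [f <-] := pres_surj pres a.
  have -> : lft (pi f) * rgt b * (lft (g j) - rgt (g j)) =
      -1 *: (lft (pi f) * rgt (g j * b)) + lft (pi (f * x j)) * rgt b.
    rewrite mulrBr -!mulrA rgt_lftC -rgtM scaleN1r addrC mulrA -lftM.
    by rewrite (pres_M pres).
  rewrite fox_lift_linear !fox_liftE -mod_proj_linear; congr mod_proj.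
  apply: funext => i; rewrite -[LHS]/(-1 *: (rgt (g j * b) * D f i) +
    rgt b * D (f * x j) i).
  rewrite (foxM pres foxD) -[x j]mulr1 (fox_gen_mul foxD) mulr1 (fox1 foxD).
  rewrite mulr0 add0r (pres_1 pres) rgt1 mulrDr scaleN1r rgtM !mulrA rgt_lftC.
  rewrite addrC addrK; move: (lft _ * _) => c.
  by case: eqP => _; [exact: mulr1|exact: mulr0].
rewrite mulrDl env_scale_mull fox_lift_linear IH IH' -mod_proj_linear.
congr mod_proj; apply: funext => i.
rewrite -[LHS]/(k *: (if i == j then t else 0) + (if i == j then t' else 0)).
by case: eqP => _ //; rewrite scaler0 addr0.
Qed.

(** Exactness at E^n: fox_lift after the differential is the projection
    modulo the rows of the Jacobian, so a row killed by the differential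
    lies in their span. *)
Lemma jacobian_exact (y : 'rV[enveloping A]_n) :
  y *m differential x pi = 0 -> exists z, z *m jacobian r D = y.
Proof.
move=> y0; suff /relation_span_gen [z zy] : submod_gen relation_span (y 0).
  by exists z; apply/rowP => i; rewrite zy.
rewrite -[y 0]subr0; apply/mod_projP; rewrite linear0.
have -> : mod_proj relation_span (y 0) =
    \sum_j mod_proj relation_span (fun i => if i == j then y 0 j else 0).
  rewrite -linear_sum; congr mod_proj; apply: funext => i.
  rewrite fct_sumE (bigD1 i) //= eqxx big1 ?addr0 // => j.
  by rewrite eq_sym => /negPf ->.
under eq_bigr do rewrite -fox_lift_differential.
rewrite -(linear_fun_sum _ fox_lift_linear).
have /matrixP/(_ 0 0) := y0; rewrite !mxE.
under eq_bigr do rewrite mxE; move=> ->.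
exact: linear_fun0 fox_lift_linear.
Qed.
End FoxExact.

Section FreeFox.
Variables (K : comNzRingType) (A : algType K) (n : nat).
Local Notation F := (free_algebra 'I_n K).
Local Notation E := (tensor A A^c).
Variable pi : F -> A.
Hypotheses (pi_linear : linear pi) (pi1 : pi 1 = 1)
  (piM : forall f f', pi (f * f') = pi f * pi f').

(** Left multiplication by x_j on the pairs (pi f, D f). Obtaining D from
    the action generated by these operators makes it well defined on the
    free algebra. *)
Definition fox_step (j : 'I_n) (v : A * ('I_n -> E)) : A * ('I_n -> E) :=
  (pi (free_gen K j) * v.1,
   fun i => lft (pi (free_gen K j)) * v.2 i + (if i == j then rgt v.1 else 0)).

Lemma fox_step_linear j : linear (fox_step j).
Proof.
move=> k [a s] [b t]; apply: (@injective_projections A ('I_n -> E)).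
  by rewrite /= mulrDr scalerAr.
apply: funext => i /=; rewrite mulrDr env_scale_mulr scalerDr addrACA.
congr (_ + _); change ((if i == j then rgt (k *: a + b) else 0) =
  k *: (if i == j then rgt a else 0) + (if i == j then rgt b else 0)).
by case: eqP => _; rewrite ?rgt_linear ?scaler0 ?addr0.
Qed.

Definition fox (f : F) : 'I_n -> E := (free_act fox_step f (1, 0)).2.

Lemma free_act_fox1 f : (free_act fox_step f (1, 0)).1 = pi f.
Proof.
elim/free_ind: f => [|i f IHf|k f1 f2 IH1 IH2].
- by rewrite free_act1 pi1.
- by rewrite piM -IHf (free_act_gen fox_step_linear).
by rewrite pi_linear -IH1 -IH2 free_act_linearl.
Qed.

Lemma free_fox_derivation : fox_derivation (@free_gen 'I_n K) pi fox.
Proof.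
split=> [k f1 f2||j f i]; first by rewrite /fox free_act_linearl.
  by rewrite /fox free_act1.
apply: etrans (congr1 (fun v => v.2 i)
  (free_act_gen fox_step_linear j f (1, 0))) _.
by rewrite -(free_act_fox1 f).
Qed.
End FreeFox.

(** * Modules cut out by an idempotent matrix *)

Section FixedRows.
Variables (E : pzRingType) (m : nat) (e : 'M[E]_m).

Definition fixed_rows : {pred 'rV[E]_m} := [pred z | z *m e == z].

Lemma fixed_rows_closed : submod_closed fixed_rows.
Proof.
split=> [|k y z]; rewrite !inE ?mul0mx // => /eqP ye /eqP ze.
by rewrite mulmxDl -scalemxAl ye ze.
Qed.
HB.instance Definition _ :=
  GRing.isSubmodClosed.Build E 'rV[E]_m fixed_rows fixed_rows_closed.

(** The image of an idempotent e, that is, the direct summand of the free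
    module formed by the rows fixed by e. *)
Record fixed_row :=
  FixedRow { fixed_val :> 'rV[E]_m; fixed_valP : fixed_val \in fixed_rows }.
HB.instance Definition _ := [isSub for fixed_val].
HB.instance Definition _ := [Choice of fixed_row by <:].
HB.instance Definition _ := [SubChoice_isSubLmodule of fixed_row by <:].

Lemma fixed_row_mul (z : fixed_row) : fixed_val z *m e = fixed_val z.
Proof. exact/eqP/fixed_valP. Qed.

Lemma fixed_val_linear : linear fixed_val. Proof. by []. Qed.
HB.instance Definition _ := GRing.isLinear.Build E fixed_row 'rV[E]_m *:%R
  fixed_val fixed_val_linear.

Lemma free_finitely_generated : finitely_generated ('rV[E]_m : lmodType E).
Proof.
exists m, (fun i => 'e_i) => z; exists (z 0); exact: row_sum_delta.
Qed.

Lemma free_projective : projective ('rV[E]_m : lmodType E).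
Proof.
move=> M N g f g_surj; have [b gb] := choice (fun i => g_surj (f 'e_i)).
pose h (z : 'rV[E]_m) := \sum_i z 0 i *: b i.
have h_lin : linear h.
  move=> k y z; rewrite /h scaler_sumr -big_split; apply: eq_bigr => i _ /=.
  by rewrite !mxE scalerDl scalerA.
pose hL := GRing.isLinear.Build E 'rV[E]_m M *:%R h h_lin.
pose hh : {linear 'rV[E]_m -> M} := HB.pack h hL.
exists hh => z; rewrite [in RHS](row_sum_delta z) /= /h !linear_sum.
by apply: eq_bigr => i _; rewrite !linearZ /= gb.
Qed.

Hypothesis e_idem : e *m e = e.

Lemma fixed_row_proj_in (z : 'rV[E]_m) : z *m e \in fixed_rows.
Proof. by rewrite inE -mulmxA e_idem. Qed.
Definition fixed_row_proj z : fixed_row := FixedRow (fixed_row_proj_in z).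

Lemma fixed_row_proj_linear : linear fixed_row_proj.
Proof.
move=> k y z; apply/val_inj; rewrite /= mulmxDl -scalemxAl.
by [].
Qed.
HB.instance Definition _ := GRing.isLinear.Build E 'rV[E]_m fixed_row *:%R
  fixed_row_proj fixed_row_proj_linear.

Lemma fixed_row_projK : cancel fixed_val fixed_row_proj.
Proof. by move=> z; apply: val_inj; rewrite /= fixed_row_mul. Qed.

Lemma fixed_row_fg : finitely_generated (fixed_row : lmodType E).
Proof.
have [k [s sP]] := free_finitely_generated.
exists k, (fixed_row_proj \o s) => z; have [c zc] := sP (fixed_val z).
exists c; rewrite -[LHS]fixed_row_projK zc linear_sum.
by apply: eq_bigr => i _; rewrite linearZ.
Qed.

Lemma fixed_row_projective : projective (fixed_row : lmodType E).
Proof.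
move=> M N g f g_surj.
have [h hP] := free_projective (f \o fixed_row_proj)%FUN g_surj.
exists (h \o fixed_val)%FUN => z.
by rewrite /= hP /= fixed_row_projK.
Qed.
End FixedRows.

(** * Smoothness from a splitting of the Jacobian *)

Section Augmentation.
Variables (K : comNzRingType) (A : algType K).

Definition augmentation (z : 'rV[enveloping A]_1) : regular_bimodule A :=
  (z 0 0 : enveloping A) *: ((1 : A) : regular_bimodule A).

Lemma lft_act1 (a : A) : env_act (lft a) 1 = a.
Proof. by apply: etrans (env_actE _ _ _) _; rewrite !mulr1. Qed.

Lemma rgt_act1 (a : A) : env_act (rgt a) 1 = a.
Proof. by apply: etrans (env_actE _ _ _) _; rewrite !mul1r. Qed.

Lemma augmentation_linear : linear augmentation.
Proof. by move=> k y z; rewrite /augmentation !mxE scalerDl scalerA. Qed.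
HB.instance Definition _ := GRing.isLinear.Build (enveloping A)
  'rV[enveloping A]_1 (regular_bimodule A) *:%R
  augmentation augmentation_linear.
End Augmentation.

Section Smooth.
Variables (K : comNzRingType) (A F : algType K) (n m : nat).
Variables (x : 'I_n -> F) (pi : F -> A) (r : 'I_m -> F).
Local Notation E := (enveloping A).
Hypothesis pres : presents x pi r.
Variable D : F -> 'I_n -> tensor A A^c.
Hypothesis foxD : fox_derivation x pi D.
Local Notation J := (jacobian r D).
Local Notation d1 := (differential x pi).

Lemma augmentation_exact (z : 'rV[E]_1) :
  augmentation z = 0 <-> exists y, y *m d1 = z.
Proof.
split=> [z0|[y <-]].
  have [y zy] := diagonal_ideal pres foxD (z 0 0); exists y.
  apply/rowP => i; rewrite ord1 -zy.
  have -> : env_act (z 0 0) 1 = 0 := z0.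
  by rewrite (linear_fun0 (@rgt_linear K A)) subr0.
rewrite /augmentation mxE scaler_suml big1 // => i _.
rewrite mxE -scalerA.
have -> : (lft (pi (x i)) - rgt (pi (x i)) : E) *:
    ((1 : A) : regular_bimodule A) = 0.
  rewrite scalerBl; apply/eqP; rewrite subr_eq0; apply/eqP.
  exact: etrans (lft_act1 _) (esym (rgt_act1 _)).
by rewrite scaler0.
Qed.

Variable e : 'M[E]_m.
Hypotheses (eJ : e *m J = J)
  (e_ker : forall y : 'rV_m, y *m J = 0 -> y *m e = 0).

(** Since eJ = J, each y - ye lies in ker J, hence is killed by e. *)
Lemma splitting_idem : e *m e = e.
Proof.
apply/eqP; rewrite -subr_eq0; apply/eqP/row_matrixP => i.
rewrite row0 linearB /=.
have := e_ker (y := row i e - delta_mx 0 i).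
rewrite mulmxBl -!row_mul -!rowE eJ subrr => /(_ erefl).
rewrite mulmxBl -rowE => e0.
by rewrite row_mul.
Qed.

(** The resolution 0 -> E^m e -> E^n -> E -> A -> 0. The module E^m e is a
    copy of the image of J, because ker J is the kernel of e. *)
Definition res_mod (i : nat) : lmodType E :=
  match i with
  | 0 => 'rV[E]_1
  | 1 => 'rV[E]_n
  | 2 => fixed_row e
  | _ => 'rV[E]_0
  end.

Definition res_map (i : nat) : {linear res_mod i.+1 -> res_mod i} :=
  match i with
  | 0 => mulmxr d1
  | 1 => mulmxr J \o fixed_val (e := e)
  | 2 => \0
  | _ => \0
  end.

Theorem presented_smooth : homologically_smooth A.
Proof.
exists res_mod, res_map, (@augmentation K A); split.
- split.
  + move=> a; exists (const_mx (lft (a : A)) : 'rV[E]_1).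
    by rewrite /= /augmentation mxE; apply: lft_act1.
  + exact: augmentation_exact.
  + case=> [|[|[|i]]] z /=.
    * split=> [z0|[y <-]].
        have [w wz] := jacobian_exact pres foxD z0.
        exists (fixed_row_proj splitting_idem w).
        by rewrite /= -mulmxA eJ.
      by rewrite -mulmxA (jacobian_differential pres foxD) mulmx0.
    * split=> [z0|[y <-]]; last by rewrite mul0mx.
      exists 0; apply: val_inj; rewrite /= -fixed_row_mul.
      by rewrite e_ker.
    * by split=> // _; exists 0; rewrite [z]thinmx0.
    * by split=> // _; exists 0; rewrite [z]thinmx0.
- case=> [|[|[|i]]] /=; split; try exact: free_finitely_generated;
    try exact: free_projective.
  + exact: fixed_row_fg splitting_idem.
  + exact: fixed_row_projective splitting_idem.
by exists 2 => -[|[|[|i]]] // _ z; apply: thinmx0.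
Qed.
End Smooth.

(** * Noncommutative normalization *)

Section NcringInstance.
Variable E : pzRingType.
#[export] Instance pzring_ops :
  @Ncring.Ring_ops E 0 1 +%R *%R (fun x y => x - y) -%R eq := {}.
#[export] Instance pzring_ncring :
  @Ncring.Ring E 0 1 +%R *%R (fun x y => x - y) -%R eq pzring_ops.
Proof.
constructor.
- exact: RelationClasses.eq_equivalence.
- by move=> ? ? -> ? ? ->.
- by move=> ? ? -> ? ? ->.
- by move=> ? ? -> ? ? ->.
- by move=> ? ? ->.
- exact: add0r.
- exact: addrC.
- exact: addrA.
- exact: mul1r.
- exact: mulr1.
- exact: mulrA.
- exact: mulrDl.
- by move=> x y z; exact: mulrDr.
- by [].
- exact: subrr.
Qed.
End NcringInstance.

(** * The Jacobian of a generalized Weyl algebra and its syzygies *)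

Definition mx_of_rows (E : pzRingType) (m n : nat) (s : seq (seq E)) :
  'M[E]_(m, n) := \matrix_(i, j) nth 0 (nth [::] s i) j.

Lemma sum4 (V : zmodType) (F : 'I_4 -> V) :
  \sum_i F i = F 0 + F 1 + F 2%:R + F 3%:R.
Proof.
rewrite !big_ord_recl big_ord0 addr0 !addrA.
by congr (F _ + F _ + F _ + F _); apply: val_inj.
Qed.

Section WeylIdentities.
Variables (E : pzRingType) (p c0 c1 X1 X2 Y1 Y2 Z1 Z2 : E).

(** Two commuting triples in E, meant to be the images of X, Y, Z under lft
    and under rgt. As rgt reverses products, the second triple satisfies the
    opposite relations. *)
Record weyl_pair : Prop := WeylPair {
  wp_cp : forall t, t * p = p * t;
  wp_c0 : forall t, t * c0 = c0 * t;
  wp_c1 : forall t, t * c1 = c1 * t;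
  wp_XZ1 : X1 * Z1 = p * Z1 * X1;
  wp_ZY1 : Z1 * Y1 = p * Y1 * Z1;
  wp_YX1 : Y1 * X1 = c0 + c1 * Z1 - Z1 * Z1;
  wp_XY1 : X1 * Y1 = c0 + p * c1 * Z1 - p * p * Z1 * Z1;
  wp_ZX2 : Z2 * X2 = p * X2 * Z2;
  wp_YZ2 : Y2 * Z2 = p * Z2 * Y2;
  wp_XY2 : X2 * Y2 = c0 + c1 * Z2 - Z2 * Z2;
  wp_YX2 : Y2 * X2 = c0 + p * c1 * Z2 - p * p * Z2 * Z2;
  wp_comm : forall a b, a \in [:: X1; Y1; Z1] -> b \in [:: X2; Y2; Z2] ->
    b * a = a * b
}.

(** Rows: the relations XZ, ZY, YX, XY. Columns: the derivatives with
    respect to X, Y, Z. *)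
Definition jac : 'M[E]_(4, 3) := mx_of_rows 4 3
  [:: [:: Z2 - p * Z1; 0; X1 - p * X2];
      [:: 0; Z1 - p * Z2; Y2 - p * Y1];
      [:: Y1; X2; - (c1 - Z1 - Z2)];
      [:: Y2; X1; - (p * (c1 - p * Z1 - p * Z2))]].

(** The syzygies given by the two ways of reducing each of the overlaps YXZ,
    XYZ, XYX, YXY of the four relations. *)
Definition syz : 'M[E]_4 := mx_of_rows 4 4
  [:: [:: - Y1; X2; Z2 - Z1; 0];
      [:: - Y2; X1; 0; p * (Z2 - Z1)];
      [:: p * Z1 + Z2 - c1; 0; - X1; X2];
      [:: 0; c1 - Z1 - p * Z2; Y2; - Y1]].

(** The coefficients on the syzygies that rebuild a row of ker jac, up to
    the factor c1^2 + 4 c0. They are read off from Delta x3 = x3 (c1 - Z1 -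
    Z2)^2 + 4 x3 Y1 X1 + x3 (2 c1 - 3 Z1 - Z2) (Z2 - Z1) for Delta = c1^2 +
    4 c0, and from its analogue for x4. *)
Definition syz_split : 'M[E]_4 := mx_of_rows 4 4
  [:: [:: - (4%:R * X1); 0; p * Z1 + Z2 - c1; 0];
      [:: 0; 0; 0; c1 - Z1 - p * Z2];
      [:: 2%:R * c1 - 3%:R * Z1 - Z2; 0; 0; 0];
      [:: 0; 2%:R * c1 - p * (3%:R * Z1 + Z2); 0; - (4%:R * X1)]].

Hypothesis wp : weyl_pair.

(** The form of a rewrite rule that applies inside a product associated to
    the left. *)
Lemma mulr_at (u v w : E) : u * v = w -> forall x, x * u * v = x * w.
Proof. by move=> <- x; rewrite mulrA. Qed.

Let com a b (ha : a \in [:: X1; Y1; Z1]) (hb : b \in [:: X2; Y2; Z2]) :=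
  wp_comm wp ha hb.
Let inX (a b c : E) : a \in [:: a; b; c]. Proof. by rewrite !inE eqxx. Qed.
Let inY (a b c : E) : b \in [:: a; b; c]. Proof. by rewrite !inE eqxx orbT. Qed.
Let inZ (a b c : E) : c \in [:: a; b; c].
Proof. by rewrite !inE eqxx !orbT. Qed.

Let rules2 := (com (inX _ _ _) (inX _ _ _), com (inX _ _ _) (inY _ _ _),
  com (inX _ _ _) (inZ _ _ _), com (inY _ _ _) (inX _ _ _),
  com (inY _ _ _) (inY _ _ _), com (inY _ _ _) (inZ _ _ _),
  com (inZ _ _ _) (inX _ _ _), com (inZ _ _ _) (inY _ _ _),
  com (inZ _ _ _) (inZ _ _ _)).
Let rules2_at := (mulr_at (com (inX _ _ _) (inX _ _ _)),
  mulr_at (com (inX _ _ _) (inY _ _ _)),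
  mulr_at (com (inX _ _ _) (inZ _ _ _)),
  mulr_at (com (inY _ _ _) (inX _ _ _)),
  mulr_at (com (inY _ _ _) (inY _ _ _)),
  mulr_at (com (inY _ _ _) (inZ _ _ _)),
  mulr_at (com (inZ _ _ _) (inX _ _ _)),
  mulr_at (com (inZ _ _ _) (inY _ _ _)),
  mulr_at (com (inZ _ _ _) (inZ _ _ _))).
Let rulesW := (wp_XZ1 wp, wp_ZY1 wp, wp_YX1 wp, wp_XY1 wp, wp_ZX2 wp,
  wp_YZ2 wp, wp_XY2 wp, wp_YX2 wp).
Let rulesW_at := (mulr_at (wp_XZ1 wp), mulr_at (wp_ZY1 wp),
  mulr_at (wp_YX1 wp), mulr_at (wp_XY1 wp), mulr_at (wp_ZX2 wp),
  mulr_at (wp_YZ2 wp), mulr_at (wp_XY2 wp), mulr_at (wp_YX2 wp)).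
Let central c (hc : forall t, t * c = c * t) :=
  (hc X1, hc X2, hc Y1, hc Y2, hc Z1, hc Z2).
Let central_at c (hc : forall t, t * c = c * t) :=
  (mulr_at (hc X1), mulr_at (hc X2), mulr_at (hc Y1), mulr_at (hc Y2),
   mulr_at (hc Z1), mulr_at (hc Z2)).
Let rulesC := (central (wp_cp wp), central (wp_c0 wp), central (wp_c1 wp),
  wp_cp wp c0, wp_cp wp c1, wp_c0 wp c1).
Let rulesC_at := (central_at (wp_cp wp), central_at (wp_c0 wp),
  central_at (wp_c1 wp),
  mulr_at (wp_cp wp c0), mulr_at (wp_cp wp c1), mulr_at (wp_c0 wp c1)).
Let expand := (mulrDl, mulrDr, mulNr, mulrN, mulrA,
  mulr_natl, mulr_natr, mulrnAl, mulrnAr, mulrnDl, mulNrn).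
Let rules := (rulesC, rulesC_at, rules2, rules2_at, rulesW, rulesW_at, expand).

(* The rewriting moves central constants to the left, then elements of index
   one, then elements of index two, and reduces each index by the relations.
   What remains is an identity between noncommutative polynomials. *)
Ltac nc := rewrite ?rules ?(mulrS, mulr0n, addr0);
  Ncring_tac.non_commutative_ring.

Lemma syz_jac : syz *m jac = 0.
Proof.
apply/matrixP => i j; rewrite !mxE !big_ord_recl big_ord0 !mxE /=.
by case: i => [[|[|[|[|//]]]] hi] /=; case: j => [[|[|[|//]]] hj] /=;
  rewrite ?(mulr0, mul0r, addr0, add0r); nc.
Qed.

Lemma row_jacP (x : 'rV[E]_4) : x *m jac = 0 ->
  let x1 := x 0 0 in let x2 := x 0 1 in let x3 := x 0 2%:R in
  let x4 := x 0 3%:R in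
  [/\ x1 * (Z2 - p * Z1) + x3 * Y1 + x4 * Y2 = 0,
      x2 * (Z1 - p * Z2) + x3 * X2 + x4 * X1 = 0
    & x1 * (X1 - p * X2) + x2 * (Y2 - p * Y1) - x3 * (c1 - Z1 - Z2)
      - x4 * (p * (c1 - p * Z1 - p * Z2)) = 0].
Proof.
move=> /matrixP xJ.
by split; [have := xJ 0 0 | have := xJ 0 1 | have := xJ 0 2%:R];
  rewrite !(sum4, mxE) /= ?(mulr0, addr0, add0r, mulrN).
Qed.

Section Split.
Hypotheses (regular_p : forall x, x * p = 0 -> x = 0)
  (regular_Z : forall x, x * (Z2 - Z1) = 0 -> x = 0).

Section Cycle.
Variables x1 x2 x3 x4 : E.
Hypotheses (eqX : x1 * (Z2 - p * Z1) + x3 * Y1 + x4 * Y2 = 0)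
  (eqY : x2 * (Z1 - p * Z2) + x3 * X2 + x4 * X1 = 0)
  (eqZ : x1 * (X1 - p * X2) + x2 * (Y2 - p * Y1) - x3 * (c1 - Z1 - Z2)
      - x4 * (p * (c1 - p * Z1 - p * Z2)) = 0).

(** By the relations, (Z2 - Z1) (c1 - Z1 - Z2) = X2 Y2 - Y1 X1. Multiplying
    eqY by Y2 and eqX by X1 on the right eliminates x4 and produces the
    common factor Z2 - Z1. *)
Lemma cycle_YX : x3 * (c1 - Z1 - Z2) = x1 * X1 + x2 * Y2.
Proof.
apply: subr0_eq; apply: regular_Z.
transitivity
  ((x2 * (Z1 - p * Z2) + x3 * X2 + x4 * X1) * Y2
   - (x1 * (Z2 - p * Z1) + x3 * Y1 + x4 * Y2) * X1).
  nc.
by rewrite eqX eqY !mul0r subr0.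
Qed.

(** Subtract cycle_YX from the third equation and divide by p. *)
Lemma cycle_XY : x4 * (c1 - p * Z1 - p * Z2) = - (x1 * X2 + x2 * Y1).
Proof.
apply: subr0_eq; apply: regular_p.
transitivity (x1 * X1 + x2 * Y2 - x3 * (c1 - Z1 - Z2) - (x1 * (X1 - p * X2)
  + x2 * (Y2 - p * Y1) - x3 * (c1 - Z1 - Z2)
  - x4 * (p * (c1 - p * Z1 - p * Z2)))); first by nc.
by rewrite eqZ cycle_YX !subrr.
Qed.

(** The Bezout identity a'^2 + 4a = Delta: the square of c1 - Z1 - Z2 is
    rewritten by cycle_YX, and the product x3 a(Z1) = x3 Y1 X1 by eqX. *)
Lemma split_YX :
  (x1 * - (4%:R * X1) + x3 * (2%:R * c1 - 3%:R * Z1 - Z2)) * (Z2 - Z1)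
  - (x1 * (p * Z1 + Z2 - c1)) * X1
  + (x2 * (c1 - Z1 - p * Z2) - x4 * (4%:R * X1)) * Y2
  = x3 * (c1 * c1 + 4%:R * c0).
Proof.
apply: subr0_eq.
transitivity (- ((x3 * (c1 - Z1 - Z2) - (x1 * X1 + x2 * Y2)) * (c1 - Z1 - Z2)
  + 4%:R * (x1 * (Z2 - p * Z1) + x3 * Y1 + x4 * Y2) * X1)).
  nc.
by rewrite cycle_YX subrr eqX mulr0 !mul0r addr0 oppr0.
Qed.

(** The same Bezout identity at p Z instead of Z, with a(p Z1) = X1 Y1. *)
Lemma split_XY :
  x4 * (2%:R * c1 - p * (3%:R * Z1 + Z2)) * (p * (Z2 - Z1))
  + (x1 * (p * Z1 + Z2 - c1)) * X2
  - (x2 * (c1 - Z1 - p * Z2) - x4 * (4%:R * X1)) * Y1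
  = x4 * (c1 * c1 + 4%:R * c0).
Proof.
apply: subr0_eq.
transitivity (- ((x4 * (c1 - p * Z1 - p * Z2) + (x1 * X2 + x2 * Y1))
  * (c1 - p * Z1 - p * Z2))); first by nc.
by rewrite cycle_XY addNr !mul0r oppr0.
Qed.
End Cycle.

(** Projecting along the syzygies: e takes x to the difference z of x and of
    its reconstruction from syz_split. If x is in ker jac, so is z, the last
    two coordinates of z vanish by split_YX and split_XY, and then the
    first two equations read z1 (Z2 - p Z1) = 0 and z2 (Z1 - p Z2) = 0. *)
Lemma split_idempotent (dinv : E) : (forall t, t * dinv = dinv * t) ->
    dinv * (c1 * c1 + 4%:R * c0) = 1 ->
    (forall x, x * (Z2 - p * Z1) = 0 -> x = 0) ->
    (forall x, x * (Z1 - p * Z2) = 0 -> x = 0) ->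
  exists e : 'M[E]_4, e *m jac = jac /\
    forall x : 'rV_4, x *m jac = 0 -> x *m e = 0.
Proof.
move=> dC dK regular_XZ regular_ZY.
(* The reconstruction of x from the syzygies; it is x itself on ker jac. *)
pose y (x : 'rV[E]_4) := dinv *: x *m syz_split *m syz.
exists (1%:M - dinv%:M *m syz_split *m syz); split=> [|x xJ].
  by rewrite mulmxBl mul1mx -mulmxA syz_jac mulmx0 subr0.
have -> : x *m (1%:M - dinv%:M *m syz_split *m syz) = x - y x.
  rewrite mulmxBr mulmx1 !mulmxA; congr (x - _ *m _ *m _).
  apply/rowP => j; rewrite !mxE (bigD1 j) //= !mxE eqxx mulr1n dC.
  rewrite big1 ?addr0 //.
  by move=> i /negPf ij; rewrite !mxE ij mulr0.
have zJ : (x - y x) *m jac = 0.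
  by rewrite mulmxBl xJ -mulmxA syz_jac mulmx0 subr0.
have /row_jacP[eX eY eZ] : dinv *: x *m jac = 0.
  by rewrite -scalemxAl xJ scaler0.
have dK' t : dinv * t * (c1 * c1 + 4%:R * c0) = t.
  by rewrite -dC -mulrA dK mulr1.
have z3 : (x - y x) 0 2%:R = 0.
  move: (split_YX eX eY); rewrite !mxE dK' => <-.
  rewrite !(sum4, mxE) /= !(mulr0, addr0, add0r, mulrN).
  by rewrite subrr.
have z4 : (x - y x) 0 3%:R = 0.
  move: (split_XY eX eY eZ); rewrite !mxE dK' => <-.
  rewrite !(sum4, mxE) /= !(mulr0, addr0, add0r, mulrN).
  by rewrite subrr.
have /row_jacP[] := zJ.
rewrite z3 z4 !mul0r !addr0 => /regular_XZ z1 /regular_ZY z2 _.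
apply/rowP => j; rewrite [RHS]mxE.
have : j \in [:: 0; 1; 2%:R; 3%:R] by case: j => [[|[|[|[|]]]]].
by rewrite !inE => /or4P[] /eqP->.
Qed.
End Split.
End WeylIdentities.

(** * A normal form for generalized Weyl algebras *)

(** The relations of the generalized Weyl algebra over K[Z] with
    automorphism Z |-> pZ and element c0 + c1 Z - Z^2. *)
Definition weyl_rels (K : comNzRingType) (F : algType K) (p c0 c1 : K)
    (X Y Z : F) : seq F :=
  [:: X * Z - p *: (Z * X); Z * Y - p *: (Y * Z);
      Y * X - (c0%:A + c1 *: Z - Z ^+ 2);
      X * Y - (c0%:A + (p * c1) *: Z - (p ^+ 2) *: Z ^+ 2)].

Section NormalForm.
Variables (K : comNzRingType) (p pinv c0 c1 : K).
Hypothesis pK : p * pinv = 1.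

Variables (M : lmodType K) (bas : int * nat -> M) (basP : free_basis bas).
Local Notation b n k := (bas ((n : int), (k : nat))).

(** The symbol bas (n, k) stands for Z^k X^n if n >= 0 and for Z^k Y^(-n) if
    n <= 0. The operators actX, actY, actZ are the left multiplications by
    X, Y, Z in these terms, and quad s is the multiplication by c0 + c1 (sZ)
    - (sZ)^2. *)
Definition actZ : {linear M -> M} := basis_lift basP (fun nk => b nk.1 nk.2.+1).

Definition quad (s : K) (v : M) : M :=
  c0 *: v + (c1 * s) *: actZ v - s ^+ 2 *: actZ (actZ v).

Lemma quad_linear s : linear (quad s).
Proof.
move=> l v w; rewrite /quad (linearP actZ l v) (linearP actZ l (actZ v)).
exact: scale_comb3.
Qed.
HB.instance Definition _ s :=
  GRing.isLinear.Build K M M *:%R (quad s) (quad_linear s).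

Definition actX : {linear M -> M} := basis_lift basP (fun nk => p ^+ nk.2 *:
  match nk.1 with
  | Posz i => b i.+1 nk.2
  | Negz i => quad p (b (- i%:Z) nk.2)
  end).

Definition actY : {linear M -> M} := basis_lift basP (fun nk => pinv ^+ nk.2 *:
  match nk.1 with
  | Posz 0 => b (Negz 0) nk.2
  | Posz i.+1 => quad 1 (b i nk.2)
  | Negz i => b (Negz i.+1) nk.2
  end).

Lemma actZE n k : actZ (b n k) = b n k.+1.
Proof. by rewrite /actZ basis_liftE. Qed.
Lemma actX_pos (i k : nat) : actX (b i k) = p ^+ k *: b i.+1 k.
Proof. by rewrite /actX basis_liftE. Qed.
Lemma actX_neg (i k : nat) :
  actX (b (Negz i) k) = p ^+ k *: quad p (b (- i%:Z) k).
Proof. by rewrite /actX basis_liftE. Qed.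
Lemma actY_neg (i k : nat) : actY (b (- i%:Z) k) = pinv ^+ k *: b (Negz i) k.
Proof. by case: i => [|i]; rewrite /actY basis_liftE. Qed.
Lemma actY_pos (i k : nat) : actY (b i.+1 k) = pinv ^+ k *: quad 1 (b i k).
Proof. by rewrite /actY basis_liftE. Qed.

Lemma actX_quad s (i k : nat) :
  actX (quad s (b i k)) = p ^+ k *: quad (s * p) (b i.+1 k).
Proof.
rewrite /quad linear_comb3 /= !actZE !actX_pos scaler_comb3.
by congr (_ + _ - _); rewrite scalerA; congr (_ *: _); rewrite ?exprS; ring.
Qed.

Lemma actY_quad s (i k : nat) :
  actY (quad s (b (- i%:Z) k)) = pinv ^+ k *: quad (s * pinv) (b (Negz i) k).
Proof.
rewrite /quad linear_comb3 /= !actZE !actY_neg scaler_comb3.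
by congr (_ + _ - _); rewrite scalerA; congr (_ *: _); rewrite ?exprS; ring.
Qed.

Lemma pexpK k : p ^+ k * pinv ^+ k = 1.
Proof. by rewrite -exprMn pK expr1n. Qed.

Lemma actYX v : actY (actX v) = quad 1 v.
Proof.
apply: (basis_ext basP (f := actY \o actX)) => -[[i|i] k] /=.
  by rewrite actX_pos linearZ /= actY_pos scalerA pexpK scale1r.
by rewrite actX_neg linearZ /= actY_quad pK scalerA pexpK scale1r.
Qed.

Lemma actXY v : actX (actY v) = quad p v.
Proof.
apply: (basis_ext basP (f := actX \o actY)) => -[[[|i]|i] k] /=.
- by rewrite (actY_neg 0) linearZ /= actX_neg scalerA mulrC pexpK scale1r.
- by rewrite actY_pos linearZ /= actX_quad mul1r scalerA mulrC pexpK scale1r.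
rewrite NegzE (actY_neg i.+1) linearZ /= actX_neg scalerA mulrC pexpK.
by rewrite scale1r.
Qed.

Lemma actZ_quad s v : actZ (quad s v) = quad s (actZ v).
Proof. by rewrite /quad linear_comb3. Qed.

Lemma actXZ v : actX (actZ v) = p *: actZ (actX v).
Proof.
apply: (basis_ext basP (f := actX \o actZ) (g := p \*: (actZ \o actX))).
case=> [n k] /=; rewrite actZE; case: n => i.
  by rewrite !actX_pos linearZ /= actZE scalerA exprS.
by rewrite !actX_neg linearZ /= actZ_quad actZE scalerA exprS.
Qed.

Lemma actZY v : actZ (actY v) = p *: actY (actZ v).
Proof.
apply: (basis_ext basP (f := actZ \o actY) (g := p \*: (actY \o actZ))).
case=> [n k] /=; have pE : p * pinv ^+ k.+1 = pinv ^+ k.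
  by rewrite exprS mulrA pK mul1r.
rewrite actZE; case: n => [[|i]|i].
- by rewrite !(actY_neg 0) linearZ /= actZE scalerA pE.
- by rewrite !actY_pos linearZ /= actZ_quad actZE scalerA pE.
by rewrite NegzE !(actY_neg i.+1) linearZ /= actZE scalerA pE.
Qed.

(** The operators satisfy the relations, so an action through them factors
    through the algebra that the relations present. *)
Lemma weyl_rels_act (F : algType K) (act : F -> M -> M) (X Y Z : F) :
    is_action act -> act X =1 actX -> act Y =1 actY -> act Z =1 actZ ->
  forall f, f \in weyl_rels p c0 c1 X Y Z -> forall v, act f v = 0.
Proof.
move=> [act_lin _ act1 actM] actXE actYE actZE' f ff v.
have actD g h : act (g + h) v = act g v + act h v.
  by rewrite -[g]scale1r act_lin !scale1r.
have actS k g : act (k *: g) v = k *: act g v.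
  by rewrite -[k *: g]addr0 act_lin (linear_fun0 (act_lin v)) addr0.
have actB g h : act (g - h) v = act g v - act h v.
  by rewrite actD -(scaleN1r h) actS scaleN1r.
move: ff; rewrite !inE => /or4P[] /eqP ->.
- by rewrite actB actS !actM !(actXE, actZE') actXZ subrr.
- by rewrite actB actS !actM !(actYE, actZE') actZY subrr.
- rewrite expr2 !(actB, actD, actS, actM, act1, actXE, actYE, actZE') actYX.
  by rewrite /quad mulr1 expr1n scale1r subrr.
rewrite expr2 !(actB, actD, actS, actM, act1, actXE, actYE, actZE') actXY.
by rewrite /quad [c1 * p]mulrC subrr.
Qed.

Section Evaluate.
Variables (A : algType K) (X Y Z : A).
Hypothesis rels : forall f, f \in weyl_rels p c0 c1 X Y Z -> f = 0.

Definition pbw_elt (n : int) : A :=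
  match n with Posz i => X ^+ i | Negz i => Y ^+ i.+1 end.

Definition pbw_eval : {linear M -> A} :=
  basis_lift basP (fun nk => Z ^+ nk.2 * pbw_elt nk.1).

Lemma pbw_evalE n k : pbw_eval (b n k) = Z ^+ k * pbw_elt n.
Proof. by rewrite /pbw_eval basis_liftE. Qed.

Lemma weyl_XZ : X * Z = p *: (Z * X).
Proof. by apply: subr0_eq; apply: rels; rewrite !inE eqxx. Qed.
Lemma weyl_ZY : Z * Y = p *: (Y * Z).
Proof. by apply: subr0_eq; apply: rels; rewrite !inE eqxx orbT. Qed.
Lemma weyl_YX : Y * X = c0%:A + c1 *: Z - Z ^+ 2.
Proof. by apply: subr0_eq; apply: rels; rewrite !inE eqxx !orbT. Qed.
Lemma weyl_XY : X * Y = c0%:A + (p * c1) *: Z - (p ^+ 2) *: Z ^+ 2.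
Proof. by apply: subr0_eq; apply: rels; rewrite !inE eqxx !orbT. Qed.

Lemma weyl_XZn k : X * Z ^+ k = p ^+ k *: (Z ^+ k * X).
Proof.
elim: k => [|k IHk]; first by rewrite !expr0 mulr1 mul1r scale1r.
rewrite !exprSr mulrA IHk -scalerAl -(mulrA _ X) weyl_XZ -scalerAr scalerA.
by rewrite mulrA.
Qed.

Lemma weyl_YZn k : Y * Z ^+ k = pinv ^+ k *: (Z ^+ k * Y).
Proof.
have YZ : Y * Z = pinv *: (Z * Y) by rewrite weyl_ZY scalerA mulrC pK scale1r.
elim: k => [|k IHk]; first by rewrite !expr0 mulr1 mul1r scale1r.
rewrite !exprSr mulrA IHk -scalerAl -(mulrA _ Y) YZ -scalerAr scalerA.
by rewrite mulrA.
Qed.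

Lemma pbw_evalZ v : pbw_eval (actZ v) = Z * pbw_eval v.
Proof.
apply: (basis_ext basP (f := pbw_eval \o actZ) (g := Z \*o pbw_eval)).
by case=> [n k] /=; rewrite actZE !pbw_evalE exprS mulrA.
Qed.

Lemma pbw_eval_quad s v : pbw_eval (quad s v) =
  (c0%:A + (s * c1) *: Z - s ^+ 2 *: Z ^+ 2) * pbw_eval v.
Proof.
rewrite /quad linear_comb3 /= !pbw_evalZ.
by rewrite mulrBl mulrDl -!scalerAl mul1r mulrA [c1 * s]mulrC.
Qed.

Lemma pbw_evalX v : pbw_eval (actX v) = X * pbw_eval v.
Proof.
apply: (basis_ext basP (f := pbw_eval \o actX) (g := X \*o pbw_eval)).
case=> [[i|i] k] /=.
  rewrite actX_pos linearZ /= !pbw_evalE (mulrA X) weyl_XZn -scalerAl.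
  by rewrite -(mulrA _ X) [pbw_elt i.+1]exprS.
rewrite actX_neg linearZ /= pbw_eval_quad -weyl_XY !pbw_evalE.
have -> : pbw_elt (- i%:Z) = Y ^+ i by case: i.
have ZC : X * Y * Z ^+ k = Z ^+ k * (X * Y).
  rewrite -(mulrA X) weyl_YZn -scalerAr (mulrA X) weyl_XZn -scalerAl scalerA.
  by rewrite mulrC pexpK scale1r mulrA.
rewrite (mulrA (X * Y)) ZC (mulrA X) weyl_XZn -scalerAl -!(mulrA (Z ^+ k)).
by rewrite -(mulrA X) [pbw_elt _]exprS.
Qed.

Lemma pbw_evalY v : pbw_eval (actY v) = Y * pbw_eval v.
Proof.
apply: (basis_ext basP (f := pbw_eval \o actY) (g := Y \*o pbw_eval)).
case=> [[[|i]|i] k] /=.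
- rewrite (actY_neg 0) linearZ /= !pbw_evalE (mulrA Y) weyl_YZn -scalerAl.
  by rewrite /= expr1 expr0 mulr1.
- rewrite actY_pos linearZ /= pbw_eval_quad expr1n mul1r scale1r -weyl_YX.
  rewrite !pbw_evalE.
  have ZC : Y * X * Z ^+ k = Z ^+ k * (Y * X).
    rewrite -(mulrA Y) weyl_XZn -scalerAr (mulrA Y) weyl_YZn -scalerAl scalerA.
    by rewrite pexpK scale1r mulrA.
  rewrite (mulrA (Y * X)) ZC (mulrA Y) weyl_YZn -scalerAl -!(mulrA (Z ^+ k)).
  by rewrite -(mulrA Y) [pbw_elt i.+1]exprS.
rewrite NegzE (actY_neg i.+1) -NegzE linearZ /= !pbw_evalE (mulrA Y).
rewrite weyl_YZn -scalerAl -(mulrA _ Y) [pbw_elt (Negz i.+1)]exprS.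
by [].
Qed.

Local Notation E := (tensor A A^c).

(** With Z1 = lft Z and Z2 = rgt Z, the symbol of Z^k e goes to the quotient
    of Z2^k - (l Z1)^k by Z2 - l Z1, multiplied by e in the second factor. *)
Definition divided_difference (l : K) : {linear M -> E} :=
  basis_lift basP (fun nk => \sum_(i < nk.2)
    l ^+ i *: (lft (Z ^+ i) * rgt (Z ^+ (nk.2 - i.+1) * pbw_elt nk.1))).

Lemma divided_differenceZ l v : divided_difference l (actZ v) =
  l *: (lft Z * divided_difference l v) + rgt (pbw_eval v).
Proof.
have lft_lin k (t t' : E) :
    l *: (lft Z * (k *: t + t')) = k *: (l *: (lft Z * t)) + l *: (lft Z * t').
  rewrite mulrDr env_scale_mulr scalerDr !scalerA.
  by rewrite [k * l]mulrC.
pose g v := l *: (lft Z * divided_difference l v) + rgt (pbw_eval v).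
have g_lin : linear g.
  move=> k u w; rewrite /g (linearP (divided_difference l) k u w).
  by rewrite (linearP pbw_eval k u w) lft_lin rgt_linear scalerDr addrACA.
pose gL : {linear M -> E} :=
  HB.pack g (GRing.isLinear.Build K M E *:%R g g_lin).
apply: (basis_ext basP (f := divided_difference l \o actZ) (g := gL)).
case=> [n k] /=; rewrite actZE /g /divided_difference !basis_liftE /=.
rewrite big_ord_recl /= expr0 scale1r expr0 lft1 mul1r subSS subn0.
rewrite addrC; congr (_ + _); rewrite mulr_sumr scaler_sumr.
apply: eq_bigr => i _; rewrite env_scale_mulr scalerA mulrA -lftM -!exprS.
by rewrite subSS.
Qed.
End Evaluate.

Section Presented.
Variables (A F : algType K) (x : 'I_3 -> F) (pi : F -> A).
Local Notation r :=
  (fun j : 'I_4 => nth 0 (weyl_rels p c0 c1 (x 0) (x 1) (x 2%:R)) j).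
Hypothesis pres : presents x pi r.
Local Notation X := (pi (x 0)).
Local Notation Y := (pi (x 1)).
Local Notation Z := (pi (x 2%:R)).

Lemma presented_rels f : f \in weyl_rels p c0 c1 X Y Z -> f = 0.
Proof.
have pil := pres_linear pres; have piM := pres_M pres.
have pi1 := pres_1 pres.
have piS k g : pi (k *: g) = k *: pi g.
  by rewrite -[k *: g]addr0 pil (linear_fun0 pil) addr0.
have piD g h : pi (g + h) = pi g + pi h by rewrite -[g]scale1r pil !scale1r.
have piB g h : pi (g - h) = pi g - pi h.
  by rewrite piD -(scaleN1r h) piS scaleN1r.
have -> : weyl_rels p c0 c1 X Y Z =
    map pi (weyl_rels p c0 c1 (x 0) (x 1) (x 2%:R)).
  by rewrite /= !(piB, piD, piS, expr2, piM, pi1).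
case/(nthP 0) => j; rewrite size_map => j4 <-; rewrite (nth_map 0) //.
by apply/(pres_ker pres)/ideal_genS; exists (Ordinal j4).
Qed.

(** The normal form of a is the result of acting with a on the symbol of 1.
    Evaluating symbols in A is equivariant, so it sends this normal form
    back to a. *)
Lemma normal_form (act : F -> M -> M) : is_action act ->
    act (x 0) =1 actX -> act (x 1) =1 actY -> act (x 2%:R) =1 actZ ->
  exists2 nf : A -> M, linear nf &
    (forall a, nf (Z * a) = actZ (nf a)) /\
    (forall a, pbw_eval X Y Z (nf a) = a).
Proof.
move=> actP actXE actYE actZE'.
have act_ker f v : pi f = 0 -> act f v = 0.
  move/(pres_ker pres) => If; apply: (action_ideal actP _ If).
  move=> _ w [j ->]; apply: weyl_rels_act actP actXE actYE actZE' _ _ w.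
  exact: mem_nth.
have [act_linl _ act1 actM] := actP.
have act_pi f g v : pi f = pi g -> act f v = act g v.
  move=> fg; apply: subr0_eq; rewrite -scaleN1r addrC -act_linl.
  by apply: act_ker; rewrite (pres_linear pres) fg scaleN1r addNr.
have evalP f v : pbw_eval X Y Z (act f v) = pi f * pbw_eval X Y Z v.
  elim/(pres_gen pres): f => [|j f IHf|k f g IHf IHg].
  - by rewrite act1 (pres_1 pres) mul1r.
  - rewrite actM (pres_M pres) -mulrA -IHf.
    have : j \in [:: 0; 1; 2%:R] by case: j => [[|[|[|]]]].
    rewrite !inE => /or3P[] /eqP->.
    + by rewrite actXE pbw_evalX //; apply: presented_rels.
    + by rewrite actYE pbw_evalY //; apply: presented_rels.
    by rewrite actZE' pbw_evalZ.
  by rewrite act_linl linearP IHf IHg (pres_linear pres) mulrDl scalerAl.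
exists (fun a => act (pres_section pres a) (b 0 0)) => [k a a'|].
  rewrite -act_linl; apply: act_pi.
  by rewrite (pres_linear pres) !pres_sectionK.
split=> a; last by rewrite evalP pres_sectionK pbw_evalE mulr1 mulr1.
rewrite -actZE' -actM; apply: act_pi.
by rewrite (pres_M pres) !pres_sectionK.
Qed.
End Presented.
End NormalForm.

(** * Regular elements of the enveloping algebra *)

Section Regular.
Variables (K : comNzRingType) (A : algType K) (z : A) (l : K).
Local Notation E := (tensor A A^c).
Variable delta : A -> E.
Hypotheses (delta_linear : linear delta)
  (deltaM : forall a, delta (z * a) = l *: (lft z * delta a) + rgt a).

(** The map a (x) b |-> lft a * delta b is a left inverse of the
    multiplication by rgt z - l lft z: applied to a (x) zb - l az (x) b it
    gives lft a (delta (zb) - l lft z delta b) = a (x) b. *)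
Lemma quantum_diagonal_regular (t : E) : t * (rgt z - l *: lft z) = 0 -> t = 0.
Proof.
pose lam : E -> E := tensor_lift (fun a (b : A^c) => lft a * delta b).
have lam_bilin : bilinear_map (fun a (b : A^c) => lft a * delta b).
  split=> [b k a a'|a k b b'].
    by rewrite lft_linear mulrDl env_scale_mull.
  by rewrite delta_linear mulrDr env_scale_mulr.
have lam_lin : linear lam := tensor_lift_linear lam_bilin.
have lamE a b : lam (lft a * rgt b) = lft a * delta b.
  by rewrite lft_rgt /lam (tensor_liftE lam_bilin).
suff lamK : lam (t * (rgt z - l *: lft z)) = t.
  by move=> t0; rewrite -lamK t0 (linear_fun0 lam_lin).
elim/env_ind: t => [a b|k t t' IH IH'].
  have -> : lft a * rgt b * (rgt z - l *: lft z) =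
      (- l) *: (lft (a * z) * rgt b) + lft a * rgt (z * b).
    rewrite mulrBr env_scale_mulr -!mulrA rgt_lftC -rgtM mulrA -lftM.
    by rewrite addrC scaleNr.
  rewrite lam_lin !lamE deltaM mulrDr env_scale_mulr mulrA -lftM scaleNr.
  by rewrite addrA addNr add0r.
by rewrite mulrDl env_scale_mull lam_lin IH IH'.
Qed.
End Regular.

(** * Smoothness of generalized Weyl algebras *)

Section WeylSmooth.
Variables (K : comNzRingType) (p pinv c0 c1 dinv : K).
Hypotheses (pK : p * pinv = 1) (dK : dinv * (c1 * c1 + 4%:R * c0) = 1).
Variables (A F : algType K) (x : 'I_3 -> F) (pi : F -> A).
Local Notation r :=
  (fun j : 'I_4 => nth 0 (weyl_rels p c0 c1 (x 0) (x 1) (x 2%:R)) j).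
Hypothesis pres : presents x pi r.
Local Notation X := (pi (x 0)).
Local Notation Y := (pi (x 1)).
Local Notation Z := (pi (x 2%:R)).
Local Notation E := (tensor A A^c).
Local Notation "k %:E" := (k *: (1 : E)) (at level 2).

Lemma env_scalarC k (t : E) : t * k%:E = k%:E * t.
Proof. by rewrite env_scale_mulr mulr1 env_scalar_mull. Qed.

Lemma env_scalar_mull2 k l (t : E) : k%:E * l%:E * t = (k * l) *: t.
Proof. by rewrite -mulrA !env_scalar_mull scalerA. Qed.

(** The relations of A, transported by the morphism lft and by the
    antimorphism rgt. *)
Lemma enveloping_weyl_pair : weyl_pair (E := enveloping A) p%:E c0%:E c1%:E
  (lft X) (rgt X) (lft Y) (rgt Y) (lft Z) (rgt Z).
Proof.
have rels := presented_rels pres.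
have XZ := weyl_XZ rels; have ZY := weyl_ZY rels.
have YX := weyl_YX rels; have XY := weyl_XY rels.
have YX1 : Y * X = c0%:A + c1 *: Z - 1 *: Z ^+ 2 by rewrite scale1r.
split; try exact: env_scalarC.
- by rewrite -lftM XZ lftZ lftM -mulrA env_scalar_mull.
- by rewrite -lftM ZY lftZ lftM -mulrA env_scalar_mull.
- by rewrite -lftM YX1 lft_quad scale1r env_scalar_mull.
- rewrite -lftM XY lft_quad expr2 -(mulrA (p%:E * p%:E)).
  by rewrite !env_scalar_mull2.
- by rewrite -rgtM XZ rgtZ rgtM -mulrA env_scalar_mull.
- by rewrite -rgtM ZY rgtZ rgtM -mulrA env_scalar_mull.
- by rewrite -rgtM YX1 rgt_quad scale1r env_scalar_mull.
- rewrite -rgtM XY rgt_quad expr2 -(mulrA (p%:E * p%:E)).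
  by rewrite !env_scalar_mull2.
by move=> a c; rewrite !inE => /or3P[] /eqP-> /or3P[] /eqP->; apply: rgt_lftC.
Qed.

Variable D : F -> 'I_3 -> E.
Hypothesis foxD : fox_derivation x pi D.

Lemma weyl_jacobian : jacobian r D =
  jac (E := enveloping A) p%:E c1%:E
    (lft X) (rgt X) (lft Y) (rgt Y) (lft Z) (rgt Z).
Proof.
have Dx j i : D (x j) i = if i == j then 1 else 0.
  rewrite -[x j]mulr1 (fox_gen_mul foxD) (fox1 foxD) mulr0 add0r.
  by rewrite (pres_1 pres).
have DS k f i : D (k *: f) i = k *: D f i.
  by rewrite -[k *: f]addr0 (foxE foxD) (linear_fun0 (fox_linear foxD)) addr0.
have DD f g i : D (f + g) i = D f i + D g i.
  by rewrite -[f]scale1r (foxE foxD) !scale1r.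
have DB f g i : D (f - g) i = D f i - D g i.
  by rewrite DD -(scaleN1r g) DS scaleN1r.
have D1 i : D 1 i = 0 by rewrite (fox1 foxD).
apply/matrixP => j i; rewrite !mxE.
case: j => [[|[|[|[|//]]]] hj] /=; rewrite ?expr2;
  rewrite !(DB, DD, DS, D1, foxM pres foxD, Dx) {hj};
  move: (lft X) (rgt X) (lft Y) (rgt Y) (lft Z) (rgt Z) => X1 X2 Y1 Y2 Z1 Z2;
  case: i => [[|[|[|//]]] hi] /=;
  rewrite ?(mulr0, mulr1, addr0, add0r, scaler0, subr0, sub0r, oppr0)
    ?env_scalar_mull // -?addrA -?opprD //.
by congr (- _); exact: scale_factor.
Qed.

Variable delta : K -> A -> E.
Hypotheses (delta_linear : forall l, linear (delta l))
  (deltaM : forall l a, delta l (Z * a) = l *: (lft Z * delta l a) + rgt a).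

Theorem weyl_smooth_of_delta : homologically_smooth A.
Proof.
have reg l t : t * (rgt Z - l *: lft Z) = 0 -> t = 0.
  exact: quantum_diagonal_regular (delta_linear l) (deltaM l) t.
have reg_p t : t * p%:E = 0 -> t = 0.
  rewrite env_scalarC env_scalar_mull => t0.
  by rewrite -[t]scale1r -pK mulrC -scalerA t0 scaler0.
have regZ t : t * (rgt Z - lft Z) = 0 -> t = 0.
  by move=> t0; apply: (reg 1); rewrite scale1r.
have regXZ t : t * (rgt Z - p%:E * lft Z) = 0 -> t = 0.
  by rewrite env_scalar_mull; apply: reg.
have regZY t : t * (lft Z - p%:E * rgt Z) = 0 -> t = 0.
  rewrite env_scalar_mull => t0; apply: (reg pinv).
  have -> : rgt Z - pinv *: lft Z = (- pinv) *: (lft Z - p *: rgt Z).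
    by rewrite scalerBr scalerA mulNr mulrC pK !scaleNr scale1r opprK addrC.
  by rewrite env_scale_mulr t0 scaler0.
have dE : dinv%:E * (c1%:E * c1%:E + 4%:R * c0%:E) = 1 :> enveloping A.
  have -> : 4%:R * c0%:E = (4%:R * c0)%:E :> E.
    by rewrite !mulr_natl scalerMnl.
  rewrite env_scalar_mull [c1%:E * _]env_scalar_mull !scalerA -scalerDl.
  by rewrite scalerA dK scale1r.
have [e [eJ e_ker]] := split_idempotent enveloping_weyl_pair reg_p regZ
  (env_scalarC dinv) dE regXZ regZY.
by apply: (presented_smooth pres foxD (e := e)); rewrite weyl_jacobian.
Qed.

End WeylSmooth.

Section FreePresentation.
Local Notation x := (free_gen _ (I := 'I_3)).

Theorem weyl_smooth (K : comNzRingType) (p pinv c0 c1 dinv : K) (A : algType K)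
    (pi : free_algebra 'I_3 K -> A) :
  p * pinv = 1 -> dinv * (c1 * c1 + 4%:R * c0) = 1 ->
  presents x pi
    (fun j : 'I_4 => nth 0 (weyl_rels p c0 c1 (x 0) (x 1) (x 2%:R)) j) ->
  homologically_smooth A.
Proof.
move=> pK dK pres.
pose basP := malg_basis K (int * nat)%type.
pose T (i : 'I_3) :=
  nth (actZ basP) [:: actX p c0 c1 basP; actY pinv c0 c1 basP] i.
have [act [actP actE]] := free_algebra_action T.
have [nf nf_lin [nfZ nfK]] :=
  normal_form pK pres actP (actE 0) (actE 1) (actE 2%:R).
have foxD :=
  free_fox_derivation (pres_linear pres) (pres_1 pres) (pres_M pres).
apply: (weyl_smooth_of_delta pK dK pres foxD (delta := fun l a =>
  divided_difference basP (pi (x 0)) (pi (x 1)) (pi (x 2%:R)) l (nf a)))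
  => [l k a a'|l a].
  by rewrite nf_lin linearP.
by rewrite nfZ divided_differenceZ nfK.
Qed.
End FreePresentation.

(** * The quantum spheres *)

Lemma ideal_gen_sub (K : comNzRingType) (F : algType K) (S S' : F -> Prop) f :
  (forall h, S h -> S' h) -> ideal_gen S f -> ideal_gen S' f.
Proof.
move=> SS'; elim=> [|h /SS'|h h' _ Ih _ Ih'|a h _ Ih|a h _ Ih].
- exact: ideal_gen0.
- exact: ideal_genS.
- exact: ideal_genB.
- exact: ideal_genMl.
exact: ideal_genMr.
Qed.

Lemma weyl_relsE (K : comNzRingType) (F : algType K) (p c0 c1 a b : K)
    (X Y Z : F) : p * c1 = a -> p ^+ 2 = b ->
  weyl_rels p c0 c1 X Y Z =
  [:: X * Z - p *: (Z * X); Z * Y - p *: (Y * Z);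
      Y * X - (c0%:A + c1 *: Z - Z ^+ 2);
      X * Y - (c0%:A + a *: Z - b *: Z ^+ 2)].
Proof. by move=> <- <-. Qed.

Section Sphere.
Local Open Scope complex_scope.
Variables (R : realType) (q u v : R).
Local Notation x := (free_gen _ (I := 'I_3)).
Local Notation F := (free_algebra 'I_3 R[i]).

(** The constants match: p c1 is q^2 (u - v) and p^2 is q^4. *)
Lemma sphere_relP (f : F) : sphere_rel q u v f <-> exists j : 'I_4,
  f = nth 0 (weyl_rels (q ^+ 2)%:C (u * v)%:C (u - v)%:C
               (x 0) (x 1) (x 2%:R)) j.
Proof.
have E0 : inord 0 = 0 :> 'I_3 by apply: val_inj; rewrite /= inordK.
have E1 : inord 1 = 1 :> 'I_3 by apply: val_inj; rewrite /= inordK.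
have E2 : inord 2 = 2%:R :> 'I_3 by apply: val_inj; rewrite /= inordK.
have Ec : (q ^+ 2)%:C * (u - v)%:C = (q ^+ 2 * (u - v))%:C :> R[i].
  exact: esym (rmorphM (real_complex R) _ _).
have Ep : (q ^+ 2)%:C ^+ 2 = (q ^+ 4)%:C :> R[i].
  by rewrite -(rmorphXn (real_complex R)) -exprM.
rewrite (weyl_relsE _ _ _ _ Ec Ep).
split=> [[]|[[[|[|[|[|//]]]] hj] ->]] /=.
- by exists 0; rewrite E0 E2.
- by exists 1; rewrite E1 E2.
- by exists 2%:R; rewrite E0 E1 E2.
- by exists 3%:R; rewrite E0 E1 E2.
- by rewrite -E2 -E0; apply: sphere_relXZ.
- by rewrite -E2 -E1; apply: sphere_relZY.
- by rewrite -E2 -E1 -E0; apply: sphere_relYX.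
by rewrite -E2 -E1 -E0; apply: sphere_relXY.
Qed.

Lemma sphere_presents : presents x
  (alg_proj (sphere_rel q u v) : F -> quantum_sphere q u v)
  (fun j : 'I_4 => nth 0 (weyl_rels (q ^+ 2)%:C (u * v)%:C (u - v)%:C
     (x 0) (x 1) (x 2%:R)) j).
Proof.
split.
- exact: free_ind.
- exact: mod_proj_linear.
- by [].
- exact: alg_projM.
- by move=> a; exists (alg_repr a); apply: alg_reprK.
move=> f; have -> : (alg_proj (sphere_rel q u v) f = 0) =
    (alg_proj (sphere_rel q u v) f = alg_proj (sphere_rel q u v) 0).
  by rewrite linear0.
split=> [/alg_projP|If]; last apply/alg_projP.
  by rewrite subr0; apply: ideal_gen_sub => h /sphere_relP.
by rewrite subr0; apply: ideal_gen_sub If => h /sphere_relP.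
Qed.
End Sphere.

Theorem corollary4p6 (R : realType) (q u v : R) (q_neq0 : q != 0)
  (q_not_root_of_unity : forall n : nat, (0 < n)%N -> q ^+ n != 1)
  (uv_neq0 : u + v != 0) :
  homologically_smooth (quantum_sphere q u v).
Proof.
apply: (weyl_smooth (p := (q ^+ 2)%:C%C) (pinv := (q ^- 2)%:C%C)
  (c0 := (u * v)%:C%C) (c1 := (u - v)%:C%C) (dinv := ((u + v) ^- 2)%:C%C));
  last exact: sphere_presents.
  by rewrite -rmorphM divff ?expf_neq0.
have -> : 4%:R = (4%:R : R)%:C%C by rewrite rmorph_nat.
rewrite -!(rmorphM, rmorphD) /=.
(* The discriminant of a(Z) = (u - Z)(v + Z). *)
have -> : (u - v) * (u - v) + 4%:R * (u * v) = (u + v) ^+ 2 by ring.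
by rewrite mulVf ?expf_neq0.
Qed.
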